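(* Let $A(x,q)=\sum_{n\ge 0} A_n^{FC}(q)\,x^n$ and $\tilde A(x,q)=\sum_{n\ge 1}\tilde A_{n-1}^{FC}(q)\,x^n$. Then $$A(x,q)=\frac{1}{1-xq}\,\frac{J(xq)}{J(x)}\qquad\text{and}\qquad \tilde A(x,q)=-x\,\frac{J'(x)}{J(x)}-\sum_{n\ge 1}\frac{x^nq^n}{1-q^n},$$ where $$J(x)=\sum_{n\ge 0}\frac{(-x)^n q^{\binom n2}}{(q;q)_n\,(xq;q)_n}$$ and $J'$ denotes the derivative with respect to $x$.
   Context: For a Coxeter system $(W,S)$, the length $\ell(w)$ of $w\in W$ is the minimal number of generators in an expression of $w$. An element $w$ is fully commutative (fc) if any reduced expression of $w$ can be obtained from any other using only commutation relations $st=ts$ (for generators $s,t$ with $m_{st}=2$). $W^{FC}(q)=\sum_{w\ \mathrm{fc}} q^{\ell(w)}$ (a formal power series in $q$). $A_n$ is the Coxeter group of type $A_n$ (the symmetric group on $n+1$ letters with its $n$ adjacent transpositions as generators), with $A_0$ the trivial group. For $n\ge 3$, $\tilde A_{n-1}$ is the affine Coxeter group whose Coxeter graph is a cycle on $n$ vertices (all $m_{st}=3$ for adjacent vertices, $2$ otherwise); $\tilde A_1$ is the infinite dihedral group (two generators $s,t$ with $m_{st}=\infty$); by convention $\tilde A_0^{FC}(q)=1$. Notation: $(a;q)_n=(1-a)(1-aq)\cdots(1-aq^{n-1})$. All series are formal power series in $x$ with coefficients in $\mathbb{Q}(q)$. *)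

(* Defs.v *)
From HB Require Import structures.
From mathcomp Require Import all_boot all_order all_algebra.
From mathcomp Require Import fraction generic_quotient finmap.
From mathcomp Require Import boolp classical_sets cardinality.
From Stdlib Require Import Relation_Operators.

Set Implicit Arguments.
Unset Strict Implicit.
Unset Printing Implicit Defensive.

Import GRing.Theory.

(* The entry 0 encodes m_st = infinity. *)
Record coxmatrix (I : finType) := CoxMatrix {
  coxm :> I -> I -> nat;
  coxm_sym : forall i j, coxm i j = coxm j i;
  coxm_diag : forall i j, (coxm i j == 1%N) = (i == j)
}.

Section CoxeterGroup.
Local Open Scope quotient_scope.
Local Open Scope group_scope.
Variables (I : finType) (M : coxmatrix I).

(* The congruence of the free monoid on I generated by (ij)^(m_ij) = 1; since
   m_ii = 1 this contains ii = 1, so the quotient monoid is the Coxeter group. *)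
Inductive cox_rel : seq I -> seq I -> Prop :=
| cox_relator i j : cox_rel (flatten (nseq (M i j) [:: i; j])) [::]
| cox_refl u : cox_rel u u
| cox_sym u v : cox_rel u v -> cox_rel v u
| cox_trans u v w : cox_rel u v -> cox_rel v w -> cox_rel u w
| cox_cat u u' v v' :
    cox_rel u u' -> cox_rel v v' -> cox_rel (u ++ v) (u' ++ v').

Definition cox_relb : rel (seq I) := fun u v => `[< cox_rel u v >].

Fact cox_relb_equiv : equiv_class_of cox_relb.
Proof.
split=> [u|u v|v u w].
- by apply/asboolP; apply: cox_refl.
- by apply/asboolP/asboolP; apply: cox_sym.
- by move=> /asboolP uv /asboolP vw; apply/asboolP; apply: cox_trans uv vw.
Qed.

Canonical cox_equiv := EquivRelPack cox_relb_equiv.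

Definition coxgroup := {eq_quot cox_equiv}.

HB.instance Definition _ := Choice.on coxgroup.

Definition cox_class (u : seq I) : coxgroup := \pi u.

Lemma cox_classP u v : cox_class u = cox_class v <-> cox_rel u v.
Proof.
split=> [/eqmodP|uv]; first by move=> /asboolP.
by apply/eqmodP; apply/asboolP.
Qed.

Lemma cox_class_repr (w : coxgroup) : cox_class (repr w) = w.
Proof. exact: reprK. Qed.

Lemma repr_cox_class u : cox_rel (repr (cox_class u)) u.
Proof. by apply/cox_classP; rewrite cox_class_repr. Qed.

Definition coxone : coxgroup := cox_class [::].
Definition coxmul (v w : coxgroup) : coxgroup := cox_class (repr v ++ repr w).
Definition coxinv (w : coxgroup) : coxgroup := cox_class (rev (repr w)).

Lemma coxmulE u v : coxmul (cox_class u) (cox_class v) = cox_class (u ++ v).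
Proof. by apply/cox_classP; apply: cox_cat; apply: repr_cox_class. Qed.

Fact coxmulA : associative coxmul.
Proof.
move=> u v w; rewrite -[u]cox_class_repr -[v]cox_class_repr -[w]cox_class_repr.
by rewrite !coxmulE catA.
Qed.

Fact coxmul1g : left_id coxone coxmul.
Proof. by move=> w; rewrite -[w]cox_class_repr coxmulE. Qed.

Fact coxmulg1 : right_id coxone coxmul.
Proof. by move=> w; rewrite -[w]cox_class_repr coxmulE cats0. Qed.

Lemma cox_rel_sqr i : cox_rel [:: i; i] [::].
Proof.
have := cox_relator i i.
by have /eqP -> : M i i == 1%N by rewrite coxm_diag eqxx.
Qed.

Lemma cox_rel_revl u : cox_rel (rev u ++ u) [::].
Proof.
elim: u => [|i u IHu]; first exact: cox_refl.
rewrite rev_cons cat_rcons -[i :: i :: u]/([:: i; i] ++ u).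
apply: cox_trans IHu; apply: cox_cat; first exact: cox_refl.
rewrite -[u in X in cox_rel _ X]cat0s.
by apply: cox_cat; [apply: cox_rel_sqr|apply: cox_refl].
Qed.

Fact coxmulVg : left_inverse coxone coxinv coxmul.
Proof.
move=> w; rewrite -[w in X in coxmul _ X]cox_class_repr coxmulE.
by apply/cox_classP/cox_rel_revl.
Qed.

Fact coxmulgV : right_inverse coxone coxinv coxmul.
Proof.
move=> w; rewrite -[w in X in coxmul X _]cox_class_repr coxmulE.
by apply/cox_classP; rewrite -{1}[repr w]revK; apply: cox_rel_revl.
Qed.

HB.instance Definition _ := isGroup.Build coxgroup
  coxmulA coxmul1g coxmulg1 coxmulVg coxmulgV.

Definition coxgen (i : I) : coxgroup := cox_class [:: i].

Definition cox_eval (u : seq I) : coxgroup := \prod_(i <- u) coxgen i.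

Lemma cox_evalE u : cox_eval u = cox_class u.
Proof.
rewrite /cox_eval; elim: u => [|i u IHu]; first by rewrite big_nil.
by rewrite big_cons IHu; exact: (coxmulE [:: i] u).
Qed.

Lemma cox_relation i j : (coxgen i * coxgen j) ^+ M i j = 1.
Proof.
have E k : (coxgen i * coxgen j) ^+ k = cox_class (flatten (nseq k [:: i; j])).
  elim: k => [//|k IHk].
  rewrite expgS IHk [coxgen i * _](coxmulE [:: i] [:: j]).
  exact: (coxmulE [:: i; j]).
by rewrite E; apply/cox_classP/cox_relator.
Qed.

Fact cox_length_ex (w : coxgroup) :
  exists k, `[< exists2 u, cox_eval u = w & size u = k >].
Proof.
exists (size (repr w)); apply/asboolP; exists (repr w) => //.
by rewrite cox_evalE cox_class_repr.
Qed.

Definition cox_length (w : coxgroup) : nat := ex_minn (cox_length_ex w).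

Definition reduced_expr (w : coxgroup) (u : seq I) : Prop :=
  cox_eval u = w /\ size u = cox_length w.

Inductive comm_step : seq I -> seq I -> Prop :=
| CommStep u v i j : M i j = 2%N ->
    comm_step (u ++ [:: i; j] ++ v) (u ++ [:: j; i] ++ v).

Definition fully_commutative (w : coxgroup) : Prop :=
  forall u v, reduced_expr w u -> reduced_expr w v ->
    clos_refl_trans _ comm_step u v.

Definition fc_of_length (k : nat) : set coxgroup :=
  [set w | fully_commutative w /\ cox_length w = k]%classic.

Lemma fc_of_length_finite k : finite_set (fc_of_length k).
Proof.
apply: (@sub_finite_set _ _
  ((fun t : k.-tuple I => cox_eval t) @` [set: k.-tuple I])%classic).
  move=> w [_]; rewrite /cox_length; case: ex_minnP => m /asboolP[u uw um] _ mk.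
  have uk : size u == k by rewrite um mk.
  by exists (Tuple uk).
by apply: finite_image; apply: finite_finset.
Qed.

End CoxeterGroup.

Arguments fc_of_length {I} M k.

Section TypeA.
Local Open Scope nat_scope.

Definition path_adj (n : nat) (i j : 'I_n) : bool :=
  (i.+1 == j) || (j.+1 == i).

Definition cycle_adj (n : nat) (i j : 'I_n) : bool :=
  (i.+1 %% n == j) || (j.+1 %% n == i).

(* The matrix of a graph all of whose edges are labelled 3. *)
Definition simply_laced n (adj : rel 'I_n) (i j : 'I_n) : nat :=
  if i == j then 1 else if adj i j then 3 else 2.

Fact simply_laced_sym n (adj : rel 'I_n) (adjC : symmetric adj) i j :
  simply_laced adj i j = simply_laced adj j i.
Proof. by rewrite /simply_laced eq_sym adjC. Qed.

Fact simply_laced_diag n (adj : rel 'I_n) i j :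
  (simply_laced adj i j == 1) = (i == j).
Proof. by rewrite /simply_laced; case: (i == j); case: (adj i j). Qed.

Fact path_adjC n : symmetric (@path_adj n).
Proof. by move=> i j; rewrite /path_adj orbC. Qed.

Fact cycle_adjC n : symmetric (@cycle_adj n).
Proof. by move=> i j; rewrite /cycle_adj orbC. Qed.

Definition coxA (n : nat) : coxmatrix 'I_n :=
  CoxMatrix (simply_laced_sym (@path_adjC n)) (@simply_laced_diag n _).

(* The cycle on n vertices; only meaningful for n >= 3. *)
Definition coxcycle (n : nat) : coxmatrix 'I_n :=
  CoxMatrix (simply_laced_sym (@cycle_adjC n)) (@simply_laced_diag n _).

Definition dihedral_infty (i j : 'I_2) : nat := if i == j then 1 else 0.

Fact dihedral_infty_sym i j : dihedral_infty i j = dihedral_infty j i.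
Proof. by rewrite /dihedral_infty eq_sym. Qed.

Fact dihedral_infty_diag i j : (dihedral_infty i j == 1) = (i == j).
Proof. by rewrite /dihedral_infty; case: (i == j). Qed.

Definition coxDinfty : coxmatrix 'I_2 :=
  CoxMatrix dihedral_infty_sym dihedral_infty_diag.

End TypeA.

Local Open Scope ring_scope.

Record fps (R : Type) := Fps { fpscoef :> nat -> R }.

Lemma fpsP (R : Type) (f g : fps R) : (forall n, f n = g n) -> f = g.
Proof. by case: f g => [f] [g] /= fg; congr Fps; apply/funext. Qed.

HB.instance Definition _ (R : Type) := gen_eqMixin (fps R).
HB.instance Definition _ (R : Type) := gen_choiceMixin (fps R).

Section FpsRing.
Variable R : comUnitRingType.
Implicit Types f g h : fps R.

Definition fps_zero : fps R := Fps (fun=> 0).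
Definition fps_opp f : fps R := Fps (fun n => - f n).
Definition fps_add f g : fps R := Fps (fun n => f n + g n).

Fact fps_addA : associative fps_add.
Proof. by move=> f g h; apply: fpsP => n; apply: addrA. Qed.
Fact fps_addC : commutative fps_add.
Proof. by move=> f g; apply: fpsP => n; apply: addrC. Qed.
Fact fps_add0 : left_id fps_zero fps_add.
Proof. by move=> f; apply: fpsP => n; apply: add0r. Qed.
Fact fps_addN : left_inverse fps_zero fps_opp fps_add.
Proof. by move=> f; apply: fpsP => n; apply: addNr. Qed.

HB.instance Definition _ := GRing.isZmodule.Build (fps R)
  fps_addA fps_addC fps_add0 fps_addN.

Definition fpsC (c : R) : fps R := Fps (fun n => if n is 0%N then c else 0).

Definition fps_mul f g : fps R :=
  Fps (fun n => \sum_(i < n.+1) f i * g (n - i)%N).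

Definition fps_trunc n f : {poly R} := \poly_(i < n) f i.

Lemma fps_mul_trunc n f g k : (k < n)%N ->
  fps_mul f g k = (fps_trunc n f * fps_trunc n g)`_k.
Proof.
move=> kn; rewrite coefM /=; apply: eq_bigr => i _.
rewrite !coef_poly (leq_ltn_trans _ kn) ?(leq_ltn_trans _ kn) ?leq_subr//.
by rewrite -ltnS.
Qed.

Fact fps_mulC : commutative fps_mul.
Proof.
move=> f g; apply: fpsP => n.
by rewrite !(@fps_mul_trunc n.+1)// mulrC.
Qed.

Lemma fps_mul_truncl n f g h k : (k < n)%N ->
  fps_mul f (fps_mul g h) k =
  (fps_trunc n f * (fps_trunc n g * fps_trunc n h))`_k.
Proof.
move=> kn; rewrite (fps_mul_trunc _ _ kn) !coefM; apply: eq_bigr => i _.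
have ki : (k - i < n)%N by rewrite (leq_ltn_trans _ kn) ?leq_subr.
by congr (_ * _); rewrite coef_poly ki (fps_mul_trunc _ _ ki).
Qed.

Fact fps_mulA : associative fps_mul.
Proof.
move=> f g h; apply: fpsP => n.
rewrite [in RHS]fps_mulC !(@fps_mul_truncl n.+1)//.
by congr (_`_n); rewrite mulrA mulrC.
Qed.

Fact fps_mul1 : left_id (fpsC 1) fps_mul.
Proof.
move=> f; apply: fpsP => n; rewrite /= big_ord_recl /= mul1r subn0.
by rewrite big1 ?addr0// => i _; rewrite mul0r.
Qed.

Fact fps_mulDl : left_distributive fps_mul fps_add.
Proof.
move=> f g h; apply: fpsP => n; rewrite /= -big_split /=.
by apply: eq_bigr => i _; rewrite mulrDl.
Qed.

Fact fps_one_neq0 : fpsC 1 != fps_zero.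
Proof. by apply/eqP => /(congr1 (fun f => f 0%N))/eqP /=; rewrite oner_eq0. Qed.

HB.instance Definition _ := GRing.Zmodule_isComNzRing.Build (fps R)
  fps_mulA fps_mulC fps_mul1 fps_mulDl fps_one_neq0.

Lemma coef_fpsM f g n : (f * g) n = \sum_(i < n.+1) f i * g (n - i)%N.
Proof. by []. Qed.

Lemma coef_fpsM0 f g : (f * g) 0%N = f 0%N * g 0%N.
Proof. by rewrite coef_fpsM big_ord1. Qed.

Lemma coef_fpsX0 f n : (f ^+ n) 0%N = f 0%N ^+ n.
Proof. by elim: n => // n IHn; rewrite !exprS coef_fpsM0 IHn. Qed.

Lemma coef_fps_sum (J : Type) (r : seq J) (P : pred J) (F : J -> fps R) n :
  (\sum_(j <- r | P j) F j) n = \sum_(j <- r | P j) F j n.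
Proof. exact: (big_morph (fun f : fps R => f n)). Qed.

Lemma coef_fpsMX_small f g k n : f 0%N = 0 -> (n < k)%N -> (f ^+ k * g) n = 0.
Proof.
move=> f0; elim: k g n => // k IHk g n nk.
rewrite exprS -mulrA coef_fpsM big1// => -[[|i] ilt] _.
  by rewrite -[f _]/(f 0%N) f0 mul0r.
rewrite IHk ?mulr0//=; move: ilt nk; rewrite !ltnS => ilt nk.
by rewrite (leq_trans _ nk)// ltn_subrL (leq_trans _ ilt).
Qed.

(* The sum of a sequence of series whose k-th term is divisible by the k-th
   power of the variable; only the first n + 1 terms then contribute to the
   coefficient of degree n. *)
Definition fps_sum (F : nat -> fps R) : fps R :=
  Fps (fun n => \sum_(k < n.+1) F k n).

Lemma fps_sum_stable (F : nat -> fps R) m n :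
  (forall k n, (n < k)%N -> F k n = 0) -> (n < m)%N ->
  fps_sum F n = (\sum_(k < m) F k) n.
Proof.
move=> F0 nm; rewrite coef_fps_sum /= -!(big_mkord xpredT (fun k => F k n)).
rewrite [RHS](big_cat_nat _ nm)//= [X in _ + X]big_nat_cond.
by rewrite [X in _ + X]big1 ?addr0// => k /andP[/andP[nk _] _]; apply: F0.
Qed.

Definition fps_unit : {pred fps R} := fun f => f 0%N \is a GRing.unit.

Definition fps_inv f : fps R :=
  if fps_unit f then
    fpsC (f 0%N)^-1 * fps_sum (fun k => (1 - fpsC (f 0%N)^-1 * f) ^+ k)
  else f.

Fact fps_mulV : {in fps_unit, left_inverse 1 fps_inv *%R}.
Proof.
move=> f; rewrite unfold_in => fU; rewrite /fps_inv [fps_unit f]fU.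
set c := fpsC _; set h := 1 - c * f.
rewrite [c * _]mulrC -mulrA; have -> : c * f = 1 - h by rewrite /h subKr.
have h0 : h 0%N = 0.
  by rewrite -[h 0%N]/(1 - (c * f) 0%N) coef_fpsM0 /= mulVr ?subrr.
apply: fpsP => n; rewrite mulrC coef_fpsM.
transitivity (((1 - h) * \sum_(k < n.+1) h ^+ k) n).
  rewrite coef_fpsM; apply: eq_bigr => i _; congr (_ * _).
  apply: fps_sum_stable; last by rewrite ltnS leq_subr.
  by move=> k m mk; rewrite -[h ^+ k]mulr1 coef_fpsMX_small.
rewrite -[1 - h]opprB mulNr -subrX1 opprB -[LHS]/((1 : fps R) n - (h ^+ n.+1) n).
by rewrite -[h ^+ n.+1]mulr1 coef_fpsMX_small ?subr0.
Qed.

Fact fps_unitPl f g : g * f = 1 -> fps_unit f.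
Proof.
move=> /(congr1 (fun f => f 0%N)); rewrite coef_fpsM0 /= => gf.
by apply/unitrPr; exists (g 0%N); rewrite mulrC.
Qed.

Fact fps_inv_out : {in [predC fps_unit], fps_inv =1 id}.
Proof. by move=> f /negPf fU; rewrite /fps_inv [fps_unit f]fU. Qed.

HB.instance Definition _ := GRing.ComNzRing_hasMulInverse.Build (fps R)
  fps_mulV fps_unitPl fps_inv_out.

Lemma fps_unitE f : (f \is a GRing.unit) = (f 0%N \is a GRing.unit).
Proof. by []. Qed.

Definition fpsX : fps R := Fps (fun n => (n == 1%N)%:R).

Definition fps_deriv f : fps R := Fps (fun n => f n.+1 *+ n.+1).

Definition fps_of_poly (p : {poly R}) : fps R := Fps (fun n => p`_n).

Lemma fps_of_polyM p r : fps_of_poly (p * r) = fps_of_poly p * fps_of_poly r.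
Proof. by apply: fpsP => n; rewrite /= coefM. Qed.

Lemma fps_of_poly_inj : injective fps_of_poly.
Proof. by move=> p r pr; apply/polyP => i; rewrite -[LHS]/(fps_of_poly p i) pr. Qed.

End FpsRing.

Arguments fpsX {R}.

Definition qpoch (R : comUnitRingType) (a q : R) (n : nat) : R :=
  \prod_(i < n) (1 - a * q ^+ i).

Definition FCseries (I : finType) (M : coxmatrix I) : fps rat :=
  Fps (fun k => (#|` fset_set (fc_of_length M k) |)%:R).

Definition A_FC (n : nat) : fps rat := FCseries (coxA n).

Definition affineA_FC (r : nat) : fps rat :=
  match r with
  | 0%N => 1
  | 1%N => FCseries coxDinfty
  | _ => FCseries (coxcycle r.+1)
  end.

Definition Qq : fieldType := {fraction {poly rat}}.

(* The power series c(q) is the expansion at q = 0 of the rational function r,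
   i.e. r = a / b and b * c = a in Q[[q]]. *)
Definition q_expansion (r : Qq) (c : fps rat) : Prop :=
  exists a b : {poly rat},
    [/\ b != 0, r = tofrac a / tofrac b & fps_of_poly b * c = fps_of_poly a].

Lemma q_expansion_inj r r' c : q_expansion r c -> q_expansion r' c -> r = r'.
Proof.
move=> [a [b [b0 -> bc]]] [a' [b' [b'0 -> bc']]].
apply/eqP; rewrite eqr_div ?tofrac_eq0// -!tofracM tofrac_eq; apply/eqP.
apply: fps_of_poly_inj; rewrite !fps_of_polyM -bc -bc'.
by rewrite -mulrA mulrC [c * _]mulrC.
Qed.

(* F is the sum of the c_n(q) x^n, and each c_n(q) is a rational function. *)
Definition is_x_series (F : fps Qq) (c : nat -> fps rat) : Prop :=
  forall n, q_expansion (F n) (c n).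

Definition varx : fps Qq := fpsX.
Definition varq : fps Qq := fpsC (tofrac 'X : Qq).

Definition Jterm (u : fps Qq) (n : nat) : fps Qq :=
  (- u) ^+ n * varq ^+ 'C(n, 2) / (qpoch varq varq n * qpoch (u * varq) varq n).

(* J(u), for a series u in x without constant term. *)
Definition J (u : fps Qq) : fps Qq := fps_sum (Jterm u).

Lemma Jterm_small (u : fps Qq) k n : u 0%N = 0 -> (n < k)%N -> Jterm u k n = 0.
Proof.
move=> u0 nk; rewrite /Jterm -mulrA coef_fpsMX_small//.
by rewrite -[(- u) 0%N]/(- u 0%N) u0 oppr0.
Qed.

Lemma qpoch_unit (a : fps Qq) n :
  (forall i, (1 - a * varq ^+ i) 0%N != 0) -> qpoch a varq n \is a GRing.unit.
Proof.
by move=> a0; apply: rpred_prod => i _; rewrite fps_unitE unitfE.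
Qed.

Lemma qpoch_q_unit n : qpoch varq varq n \is a GRing.unit.
Proof.
apply: qpoch_unit => i; rewrite -exprS.
rewrite -[X in X != 0]/(1 - (varq ^+ i.+1) 0%N) coef_fpsX0 /= -tofracXn.
rewrite -tofrac1 -tofracB tofrac_eq0; apply/eqP => /(congr1 (coefp 0))/eqP.
by rewrite /= coefB coef1 coefXn coef0 subr0 oner_eq0.
Qed.

Lemma qpoch_u_unit (u : fps Qq) n :
  u 0%N = 0 -> qpoch (u * varq) varq n \is a GRing.unit.
Proof.
move=> u0; apply: qpoch_unit => i; rewrite -mulrA.
rewrite -[X in X != 0]/(1 - (u * (varq * varq ^+ i)) 0%N) coef_fpsM0 u0 mul0r.
by rewrite subr0 oner_eq0.
Qed.

Lemma J_unit (u : fps Qq) : J u \is a GRing.unit.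
Proof.
rewrite fps_unitE -[J u 0%N]/(\sum_(k < 1) Jterm u k 0%N) big_ord1.
rewrite /Jterm /qpoch !big_ord0.
by rewrite !expr0 !mulr1 invr1 mulr1 unitr1.
Qed.

(* Main.v *)
Require Import Defs.
From HB Require Import structures.
From mathcomp Require Import all_boot all_order all_algebra.
From mathcomp Require Import fraction zify ring.
From mathcomp Require Import boolp classical_sets cardinality finmap.
From Stdlib Require Import Relation_Operators.

Set Implicit Arguments.
Unset Strict Implicit.
Unset Printing Implicit Defensive.

Import GRing.Theory.

(** A fully commutative element is a commutation class of words none of which
    contains a factor [ii] or [iji] with [m_ij = 3]; this follows from the
    exchange property, itself a consequence of the parity of the number of times
    a reflection occurs along a word.  On a path or a cycle such words alternate
    along every edge, so a class is determined by the number [c_i] of letters [i]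
    and, for each edge, the letter that comes first.  Hence [A_n] is counted by
    walks [0 = c_0, c_1, ..., c_n, 0] with steps 0, 1, -1, where a level step has
    two labels at positive height and one at height 0, and [q] marks the sum of
    the heights; the affine group is counted by closed walks, minus the two
    constant walks at each positive height whose labels would be cyclic.

    With [H(x) = sum_n q^n t_n(x)], where [t_n] is the n-th term of [J], one has
    [H(x) = J(x) + x J(xq) / (1 - xq)] and [(1 - xq) H(x) = Q(xq)] for
    [Q = J - x H].  The linear system satisfied by the walk series then gives
    [H / J] for the walks from 0 to 0, and [H / Q] if the level steps at height 0
    also have two labels.  Closed walks that touch height 0 are counted by the
    logarithmic derivatives of these two series, and every closed walk is a
    translate of one of them; the [Q]-contributions telescope and leave
    [- x J' / J]. *)

(** * Words and the exchange property *)

Section Words.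
Local Open Scope group_scope.
Variables (I : finType) (M : coxmatrix I).
Implicit Types (u v a b c : seq I) (i j x : I).

Local Notation E := (cox_eval M).

Lemma cox_eval_nil : E [::] = 1.
Proof. by rewrite /cox_eval big_nil. Qed.

Lemma cox_eval_cons i u : E (i :: u) = coxgen M i * E u.
Proof. by rewrite /cox_eval big_cons. Qed.

Lemma cox_eval_cat u v : E (u ++ v) = E u * E v.
Proof. by rewrite /cox_eval big_cat. Qed.

Lemma cox_eval_rel u v : cox_rel M u v <-> E u = E v.
Proof. by rewrite !cox_evalE; split=> /cox_classP. Qed.

Lemma coxgen_sqr i : coxgen M i * coxgen M i = 1.
Proof.
have := cox_relation M i i.
by have /eqP -> : M i i == 1%N by rewrite coxm_diag.
Qed.

Lemma coxgenV i : (coxgen M i)^-1 = coxgen M i.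
Proof. by apply: (mulgI (coxgen M i)); rewrite mulgV coxgen_sqr. Qed.

Lemma cox_genK i u v : E (i :: u) = E (i :: v) -> E u = E v.
Proof. by rewrite !cox_eval_cons => /mulgI. Qed.

Lemma cox_eval_genl i u v : E (i :: u) = E v -> E u = E (i :: v).
Proof. by rewrite !cox_eval_cons => <-; rewrite mulgA coxgen_sqr mul1g. Qed.

(** An action of the letters that respects the relators descends to the group. This is how words are
    shown to have different values. *)
Lemma cox_rep (T : Type) (act : I -> T -> T) :
  (forall i j y, iter (M i j) (act i \o act j) y = y) ->
  forall u v, E u = E v -> forall y, foldr act y u = foldr act y v.
Proof.
move=> act1 u v /cox_eval_rel; elim=> {u v}.
- move=> i j y; rewrite -[RHS](act1 i j y).
  by elim: (M i j) => //= m ->.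
- by [].
- by move=> u v _ IH y; rewrite IH.
- by move=> u v w _ IHu _ IHv y; rewrite IHu.
- by move=> u u' v v' _ IHu _ IHv y; rewrite !foldr_cat IHv IHu.
Qed.

(* The parity of the number of prefixes a i of u with t a = a i, that is of the
   number of times the reflection t occurs among the a i a^-1. *)
Fixpoint inv_parity u (t : coxgroup M) : bool :=
  if u is i :: u' then (t == coxgen M i) (+) inv_parity u' (t ^ coxgen M i)
  else false.

Lemma inv_parity_cat u v (t : coxgroup M) :
  inv_parity (u ++ v) t = inv_parity u t (+) inv_parity v (t ^ E u).
Proof.
elim: u t => [|i u IHu] t /=; first by rewrite cox_eval_nil conjg1.
by rewrite IHu cox_eval_cons conjgM addbA.
Qed.

(** With r = s_i s_j, the reflections met along the relator are the r^l s_i for l < 2m. Since r^m =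
    1, the second half of this list repeats the first, and every parity is even. *)
Lemma inv_parity_relator i j (t : coxgroup M) :
  inv_parity (flatten (nseq (M i j) [:: i; j])) t = false.
Proof.
set r := coxgen M i * coxgen M j.
have ir l : coxgen M i * r ^- l = r ^+ l * coxgen M i.
  elim: l => [|l IHl]; first by rewrite expg0 invg1 mulg1 mul1g.
  have -> : coxgen M i * r ^- l.+1 = r * (coxgen M i * r ^- l).
    by rewrite expgSr !invgM !coxgenV !mulgA.
  by rewrite IHl mulgA -expgS.
have P m : inv_parity (flatten (nseq m [:: i; j])) t =
    \big[addb/false]_(0 <= l < m.*2) (t == r ^+ l * coxgen M i).
  elim: m => [|m IHm]; first by rewrite big_nil.
  have -> : flatten (nseq m.+1 [:: i; j]) =
      flatten (nseq m [:: i; j]) ++ [:: i; j].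
    by rewrite -addn1 nseqD flatten_cat.
  have -> : m.+1.*2 = m.*2.+2 by [].
  rewrite inv_parity_cat IHm !big_nat_recr //= -addbA; congr addb.
  have -> : E (flatten (nseq m [:: i; j])) = r ^+ m.
    elim: m {IHm} => [|m IHm]; first by rewrite cox_eval_nil.
    by rewrite /= !cox_eval_cons IHm mulgA expgS.
  have eqJ (y z w : coxgroup M) : (y ^ w == z) = (y == w * z * w^-1).
    by rewrite -(inj_eq (@conjg_inj _ w^-1)) conjgK conjgE invgK mulgA.
  rewrite addbF; congr addb; rewrite !eqJ.
    by congr (_ == _); rewrite -mulgA ir mulgA -expgnDr addnn.
  congr (_ == _); rewrite !coxgenV.
  have -> : coxgen M i * coxgen M j * coxgen M i = r * coxgen M i by [].
  by rewrite mulgA -expgSr -mulgA ir mulgA -expgnDr addSn addnn.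
rewrite P -addnn; set m := M i j.
rewrite (@big_cat_nat _ _ _ m) ?leq_addr //=.
rewrite -{2}[m]add0n big_addn addnK.
rewrite [X in _ (+) X](_ : _ = \big[addb/false]_(0 <= l < m) (t == r ^+ l * coxgen M i)).
  by rewrite addbb.
by apply: eq_bigr => l _; rewrite expgnDr cox_relation mulg1.
Qed.

Lemma inv_parity_eval u v t : E u = E v -> inv_parity u t = inv_parity v t.
Proof.
move=> /cox_eval_rel uv; elim: uv t => {u v}.
- exact: inv_parity_relator.
- by [].
- by move=> u v _ IH t; rewrite IH.
- by move=> u v w _ IHu _ IHv t; rewrite IHu.
- move=> u u' v v' /cox_eval_rel uu' IHu _ IHv t.
  by rewrite !inv_parity_cat IHu IHv uu'.
Qed.

(** An odd number of occurrences is at least one, and an occurrence at the letter x after the prefix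
    [a] means t = a x a^-1. *)
Lemma inv_parity_exchange u t : inv_parity u t ->
  exists a x b, u = a ++ x :: b /\ t * E a = E (a ++ [:: x]).
Proof.
elim: u t => //= i u IHu t.
case: eqP => [-> _|_ /= /IHu [a [x [b [-> tE]]]]].
  by exists [::], i, u; rewrite cox_eval_cons cox_eval_nil.
exists (i :: a), x, b; split=> //.
rewrite /= !cox_eval_cons -tE conjgE coxgenV !mulgA.
by rewrite coxgen_sqr mul1g.
Qed.

(** The generator i is fixed under conjugation by itself, so a letter i put in front adds exactly
    one occurrence. *)
Lemma inv_parity_head i u :
  inv_parity (i :: u) (coxgen M i) = ~~ inv_parity u (coxgen M i).
Proof. by rewrite /= eqxx conjgE coxgenV coxgen_sqr mulg1. Qed.

Lemma cox_exchange i u : inv_parity u (coxgen M i) ->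
  exists a x b, u = a ++ x :: b /\ E (i :: a) = E (a ++ [:: x]).
Proof.
by move=> /inv_parity_exchange[a [x [b [-> h]]]]; exists a, x, b; rewrite cox_eval_cons.
Qed.

End Words.

(** * Words of fully commutative elements *)

Section SimplyLacedWords.
Variables (I : finType) (M : coxmatrix I).
Hypothesis M_le3 : forall i j, (0 < M i j <= 3)%N.
Implicit Types (u v a b c p r : seq I) (i j x s t : I).

Local Notation E := (cox_eval M).

Section GeometricRepresentation.
Local Open Scope ring_scope.
Implicit Types (f : I -> int).

(** The reflection representation in the basis of simple roots: [refl_shift i f] is -2B(alpha_i, f),
    an integer because all m_ij are at most 3. *)
Definition refl_shift i f : int := \sum_(j | M i j == 3%N) f j - f i *+ 2.
Definition refl_act i f : I -> int :=
  fun x => f x + (if x == i then refl_shift i f else 0).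

Lemma refl_actE i f x :
  refl_act i f x = f x + (if x == i then refl_shift i f else 0).
Proof. by []. Qed.

Lemma refl_shift_act i j f : refl_shift i (refl_act j f) = refl_shift i f +
  (if M i j == 3%N then 1 else if i == j then -2 else 0) * refl_shift j f.
Proof.
rewrite {1}/refl_shift /refl_act big_split /= -big_mkcondr /=.
have [m3|m3] := eqVneq (M i j) 3%N.
  have -> : (i == j) = false by rewrite -(coxm_diag M) m3.
  rewrite [X in _ + X - _](big_pred1 j) /=; last first.
    by move=> k; rewrite /=; case: (eqVneq k j) => [->|]; rewrite /= ?m3 ?eqxx ?andbF.
  by rewrite /refl_shift; ring.
rewrite [X in _ + X - _]big_pred0; last first.
  by move=> k; case: (eqVneq k j) => [->|]; rewrite ?(negPf m3) ?andbF.
by case: eqP => [->|_]; rewrite /refl_shift; ring.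
Qed.

Lemma refl_act_relation i j f :
  iter (M i j) (refl_act i \o refl_act j) f = f.
Proof.
have Mii k : M k k = 1%N by apply/eqP; rewrite coxm_diag.
have := M_le3 i j.
have [<-|ij] := eqVneq i j => [|].
  rewrite Mii /= => _; apply/funext => x; rewrite /= !refl_actE refl_shift_act.
  by rewrite Mii eqxx /=; case: eqP => _; ring.
have := coxm_diag M i j; rewrite (negPf ij).
case m: (M i j) => [|[|[|[|]]]] // _ _.
  apply/funext => x; rewrite /= !refl_actE !refl_shift_act !Mii.
  rewrite (coxm_sym M j i) m !eqxx /= (negPf ij) (eq_sym j) (negPf ij).
  by case: (x == i); case: (x == j); ring.
apply/funext => x; rewrite /= !refl_actE !refl_shift_act !Mii.
rewrite (coxm_sym M j i) m !eqxx /=.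
by case: (x == i); case: (x == j); ring.
Qed.

(** The generator i sends alpha_i to its opposite, while any other generator leaves the coordinate
    at i unchanged. *)
Lemma coxgen_inj i j : E [:: i] = E [:: j] -> i = j.
Proof.
move=> /(cox_rep refl_act_relation) /(_ (fun x => (x == i)%:R)).
move=> /(congr1 (fun f => f i)) /=; rewrite /refl_act eqxx.
case: (eqVneq i j) => // ij.
rewrite /refl_shift eqxx big1 => [//|k]; case: (eqVneq k i) => [->|//].
by have /eqP -> : M i i == 1%N by rewrite coxm_diag.
Qed.

End GeometricRepresentation.

Definition comm_eq : seq I -> seq I -> Prop := clos_refl_trans _ (comm_step M).

Lemma comm_eq_sym u v : comm_eq u v -> comm_eq v u.
Proof.
elim=> [_ _ [a b i j ij]|w|w w' w'' _ IH _ IH'].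
- by apply: rt_step; apply: CommStep; rewrite coxm_sym.
- exact: rt_refl.
- exact: rt_trans IH' IH.
Qed.

Lemma comm_eq_cat p u v r : comm_eq u v -> comm_eq (p ++ u ++ r) (p ++ v ++ r).
Proof.
elim=> [_ _ [a b i j ij]|w|w w' w'' _ IH _ IH'].
- rewrite -!(catA a) !(catA p) -!catA; apply: rt_step.
  by rewrite !(catA p); apply: CommStep.
- exact: rt_refl.
- exact: rt_trans IH IH'.
Qed.

Lemma comm_eq_cons i u v : comm_eq u v -> comm_eq (i :: u) (i :: v).
Proof. by move=> /(@comm_eq_cat [:: i] _ _ [::]); rewrite !cats0. Qed.

Lemma comm_eq_catr u v r : comm_eq u v -> comm_eq (u ++ r) (v ++ r).
Proof. exact: (@comm_eq_cat [::]). Qed.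

Lemma comm_eq_catl p u v : comm_eq u v -> comm_eq (p ++ u) (p ++ v).
Proof. by move=> /(@comm_eq_cat p _ _ [::]); rewrite !cats0. Qed.

Lemma comm_eq_swap i j u : M i j = 2 -> comm_eq (i :: j :: u) (j :: i :: u).
Proof. by move=> ij; apply: rt_step; apply: (@CommStep _ _ [::] u). Qed.

Lemma comm_eq_perm u v : comm_eq u v -> perm_eq u v.
Proof.
elim=> [_ _ [a b i j _]|w|w w' w'' _ IH _ IH']; rewrite ?perm_refl //.
  by rewrite perm_cat2l perm_cat2r (perm_catC [:: i] [:: j]).
exact: perm_trans IH IH'.
Qed.

Lemma comm_eq_size u v : comm_eq u v -> size u = size v.
Proof. by move=> /comm_eq_perm/perm_size. Qed.

Lemma cox_eval_cat2 p u v r : E u = E v -> E (p ++ u ++ r) = E (p ++ v ++ r).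
Proof. by rewrite !cox_eval_cat => ->. Qed.

Lemma cox_eval_exchange s x a b :
  E (s :: a) = E (a ++ [:: x]) -> E (a ++ x :: b) = E (s :: a ++ b).
Proof.
by move=> saE; rewrite -cat_rcons -cats1 -cat_cons !(cox_eval_cat M _ b) saE.
Qed.

Lemma cox_eval_sqr i : E [:: i; i] = E [::].
Proof. by apply/cox_eval_rel; apply: cox_rel_sqr. Qed.

Lemma cox_eval_swap i j : M i j = 2 -> E [:: i; j] = E [:: j; i].
Proof.
move=> ij; apply/cox_eval_genl/cox_eval_genl.
by have /cox_eval_rel := cox_relator M i j; rewrite ij => ->.
Qed.

Lemma cox_eval_braid i j : M i j = 3 -> E [:: i; j; i] = E [:: j; i; j].
Proof.
move=> ij; apply/esym/cox_eval_genl/cox_eval_genl/cox_eval_genl.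
by have /cox_eval_rel := cox_relator M i j; rewrite ij => ->.
Qed.

Lemma comm_eq_eval u v : comm_eq u v -> E u = E v.
Proof.
elim=> [_ _ [a b i j ij]|w|w w' w'' _ -> _ -> //] //.
exact/cox_eval_cat2/cox_eval_swap.
Qed.

(** For m_ij = 3, commutation and the braid relation would cancel to an equality of the two
    generators, against [coxgen_inj]. *)
Lemma coxgen_comm_inv i j : i != j -> E [:: i; j] = E [:: j; i] -> M i j = 2.
Proof.
move=> ij ijE; have := M_le3 i j; have := coxm_diag M i j.
rewrite (negPf ij); case m: (M i j) => [|[|[|[|]]]] // _ _.
have := cox_eval_braid m; rewrite -[[:: i; j; i]]/([:: i; j] ++ [:: i]).
rewrite cox_eval_cat ijE -cox_eval_cat => /cox_genK/cox_genK/coxgen_inj ij'.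
by rewrite ij' eqxx in ij.
Qed.

(* These are the reduced words of the fully commutative elements: see
   fc_word_fc and fc_word_of_fc. *)
Definition fc_word u := forall v, comm_eq u v ->
  (forall a i b, v <> a ++ [:: i; i] ++ b) /\
  (forall a i j b, M i j = 3 -> v <> a ++ [:: i; j; i] ++ b).

Lemma fc_word_comm u v : comm_eq u v -> fc_word u -> fc_word v.
Proof. by move=> uv fu w vw; apply: fu; apply: rt_trans uv vw. Qed.

Lemma fc_word_factor p u r : fc_word (p ++ u ++ r) -> fc_word u.
Proof.
move=> fu v /(@comm_eq_cat p _ _ r)/fu[h1 h2]; split=> [a i b|a i j b ij] vE.
  by apply: (h1 (p ++ a) i (b ++ r)); rewrite vE !catA.
by apply: (h2 (p ++ a) i j (b ++ r) ij); rewrite vE !catA.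
Qed.

Lemma fc_word_no_sqr p i r : ~ fc_word (p ++ [:: i, i & r]).
Proof. by move=> /(_ _ (rt_refl _ _ _))[/(_ p i r)]. Qed.

Lemma fc_word_no_iji p i j r : ~ fc_word (p ++ [:: i, j, i & r]).
Proof.
move=> fu; have := M_le3 i j.
case m: (M i j) => [|[|[|[|]]]] // _.
- have /eqP ij : i == j by rewrite -(coxm_diag M) m.
  by move: fu; rewrite ij; apply: fc_word_no_sqr.
- apply: (@fc_word_no_sqr p i (j :: r)); apply: fc_word_comm fu.
  by apply/comm_eq_catl/comm_eq_cons/comm_eq_swap; rewrite coxm_sym.
- by have [_ /(_ p i j r m)] := fu _ (rt_refl _ _ _).
Qed.

(** Induction on the length of [u] = s u'. Exchange turns [v] = a x b into s a b, and the remainders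
    are compared by induction. Where commutations do not suffice, some word equivalent to [u] would
    contain a square or a factor iji, or the element would have a shorter expression. *)
Theorem fc_word_unique u v :
  fc_word u -> E u = E v -> (size v <= size u)%N -> comm_eq u v.
Proof.
have [k] := ubnP (size u); elim: k u v => // k IH [|s u'] v.
  by case: v => // *; apply: rt_refl.
rewrite ltnS => uk fu uv vu.
have fu' : fc_word u'.
  by apply: (@fc_word_factor [:: s] _ [::]); rewrite cats0.
(* Otherwise exchange in u' and the induction hypothesis bring an s to the front of u', and [u] is
   equivalent to a word starting with s s. *)
have odd_s : inv_parity (s :: u') (coxgen M s).
  rewrite inv_parity_head; apply/negP => /cox_exchange[a [x [b [u'E saE]]]].
  have /(IH _ _ uk fu') cu' : E u' = E (s :: a ++ b).
    by rewrite u'E; apply: cox_eval_exchange.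
  have /fc_word_comm/(_ fu) : comm_eq (s :: u') (s :: s :: a ++ b).
    apply/comm_eq_cons/cu'.
    by rewrite u'E /= !size_cat /= addnS.
  exact: (@fc_word_no_sqr [::]).
have exch v' : E (s :: u') = E v' -> (size v' <= size (s :: u'))%N ->
    exists a x b, [/\ v' = a ++ x :: b, E (s :: a) = E (a ++ [:: x]),
      comm_eq (s :: u') (s :: a ++ b) & size v' = size (s :: u')].
  move=> uv' v'u; have := odd_s; rewrite (inv_parity_eval _ uv').
  move=> /cox_exchange[a [x [b [v'E saE]]]]; exists a, x, b.
  have /(IH _ _ uk fu') cu' : E u' = E (a ++ b).
    by apply: (@cox_genK _ _ s); rewrite uv' v'E; apply: cox_eval_exchange.
  have sv' : size v' = (size (a ++ b)).+1 by rewrite v'E !size_cat addnS.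
  have {}cu' := cu' _.
  rewrite sv' in v'u; have /comm_eq_size su' := cu' v'u.
  by split=> //=; [apply/comm_eq_cons/cu' | rewrite sv' su'].
have [a [t [b [vE saE usab sv]]]] := exch v uv vu.
have fsab := fc_word_comm usab fu.
have su := comm_eq_size usab.
(* If letters follow t, the induction hypothesis applies to the shorter words s a and a t. *)
case: b => [|y b] in vE usab fsab su *; last first.
  apply: rt_trans usab _; rewrite vE -cat_cons -[a ++ t :: _]cat_rcons -cats1.
  apply: comm_eq_catr; apply: IH => //.
  - by apply: leq_trans uk; rewrite su /= size_cat /= addnS !ltnS leq_addr.
  - exact: (@fc_word_factor [::] _ (y :: b)).
  - by rewrite size_cat addn1.
rewrite cats0 in usab fsab su; case: a => [|r a] in vE saE usab fsab su *.
  by apply: rt_trans usab _; rewrite vE (coxgen_inj saE); apply: rt_refl.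
have short w : E (s :: u') = E w -> (size w < size (s :: u'))%N -> False.
  by move=> uw /[dup] /ltnW /(exch _ uw)[? [? [? [_ _ _ ->]]]]; rewrite ltnn.
(* Now [v] = r a t. If the parity were even, exchange in a t would remove two letters from [v]. *)
have odd_r : inv_parity [:: s, r & a] (coxgen M r).
  rewrite (@inv_parity_eval _ _ _ v); last by rewrite -uv (comm_eq_eval usab).
  rewrite vE cat_cons inv_parity_head; apply/negP.
  move=> /cox_exchange[a2 [x [b2 [atE raE]]]]; apply: (short (a2 ++ b2)).
    rewrite uv vE cat_cons; apply/esym/cox_eval_genl; rewrite atE.
    exact/esym/cox_eval_exchange.
  move: sv; rewrite vE cat_cons atE /= !size_cat /= addnS => <-.
  by rewrite ltnS leqnSn.
have sr : s != r by apply/eqP => sr; move: fsab; rewrite sr; apply: (@fc_word_no_sqr [::]).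
(* The letter removed by exchange is s, r or a letter of [a]. The first case gives s = r, the second
   makes s and r commute. *)
move: odd_r => /cox_exchange[[|s' [|r' b]] [x [c [srE rE]]]].
- by move: srE sr rE => [-> _] /eqP sr /coxgen_inj /esym.
- move: srE rE => [<- <- _] /esym rE; have m := coxgen_comm_inv sr rE.
  have usabE := comm_eq_eval usab; apply: rt_trans usab _; rewrite vE.
  apply: rt_trans (comm_eq_swap _ m) _; apply: comm_eq_cons.
  have sasr : comm_eq [:: s, r & a] (r :: s :: a) by apply: comm_eq_swap.
  apply: IH.
  + by apply: leq_trans uk; rewrite su.
  + apply: (@fc_word_factor [:: r] _ [::]); rewrite cats0.
    exact: fc_word_comm sasr fsab.
  + apply: (@cox_genK _ _ r); rewrite -(comm_eq_eval sasr) -usabE.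
    by rewrite uv vE.
  + by rewrite size_cat addn1.
move: srE rE => [<- <- aE]; move: aE fsab usab su => -> fsab usab su rE.
(* If the removed letter is the last one, m_sr = 2 gives a shorter expression and m_sr = 3 makes [u]
   equivalent to s r s b. Otherwise the induction hypothesis for the prefix s r b x produces a
   factor r s r. *)
case: c => [|y c] in usab fsab su *.
  have rE' : E (s :: u') = E [:: r, s, r & b] by rewrite (comm_eq_eval usab) rE.
  have := M_le3 s r; have := coxm_diag M s r; rewrite (negPf sr).
  case m: (M s r) => [|[|[|[|]]]] // _ _.
    exfalso; apply: (short (s :: b)); last by rewrite su /= size_cat addn1.
    rewrite rE' -[[:: r, s, r & b]]/([:: r; s] ++ [:: r] ++ b) cox_eval_cat.
    rewrite -(cox_eval_swap m) -cox_eval_cat.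
    by rewrite -[LHS]/(E ([:: s] ++ [:: r; r] ++ b)) (cox_eval_cat2 _ _ (cox_eval_sqr r)).
  have bxE : E (b ++ [:: x]) = E (s :: b).
    apply: (@cox_genK _ _ r); apply: (@cox_genK _ _ s).
    rewrite -[LHS](comm_eq_eval usab) rE'.
    exact/esym/(@cox_eval_cat2 [::] [:: s; r; s] [:: r; s; r] b)/cox_eval_braid.
  have fbx : fc_word (b ++ [:: x]).
    by apply: (@fc_word_factor [:: s; r] _ [::]); rewrite cats0.
  have cbx : comm_eq (b ++ [:: x]) (s :: b).
    apply: IH => //; last by rewrite size_cat addn1.
    by apply: leq_trans uk; rewrite su /= ltnS leqnSn.
  have /fc_word_comm/(_ fsab) : comm_eq [:: s, r & b ++ [:: x]] [:: s, r, s & b].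
    by do 2!apply: comm_eq_cons.
  by move/(@fc_word_no_iji [::]).
have cxb : comm_eq ([:: s, r & b] ++ [:: x]) [:: r, s, r & b].
  apply: IH => //.
  - by apply: leq_trans uk; rewrite su /= !size_cat /=; lia.
  - by apply: (@fc_word_factor [::] _ (y :: c)); rewrite /= -catA.
  - by rewrite /= size_cat addn1.
have /fc_word_comm : comm_eq [:: s, r & b ++ x :: y :: c] ([:: r, s, r & b] ++ y :: c).
  by have := comm_eq_catr (y :: c) cxb; rewrite /= -catA.
by move=> /(_ fsab)/(@fc_word_no_iji [::]).
Qed.

Lemma cox_length_expr (w : coxgroup M) :
  exists2 u, E u = w & size u = cox_length w.
Proof. by rewrite /cox_length; case: ex_minnP => m /asboolP. Qed.

Lemma cox_length_le u : (cox_length (E u) <= size u)%N.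
Proof.
by rewrite /cox_length; case: ex_minnP => m _; apply; apply/asboolP; exists u.
Qed.

Lemma fc_word_length u : fc_word u -> cox_length (E u) = size u.
Proof.
move=> fu; have [v vE vs] := cox_length_expr (E u).
by rewrite -vs (comm_eq_size (fc_word_unique fu (esym vE) _)) // vs cox_length_le.
Qed.

Lemma fc_word_fc u : fc_word u -> fully_commutative (E u).
Proof.
move=> fu v w [vE vs] [wE ws]; apply: (@rt_trans _ _ _ u).
  by apply/comm_eq_sym/fc_word_unique; rewrite ?vs ?fc_word_length.
by apply/fc_word_unique; rewrite ?ws ?fc_word_length.
Qed.

(** A square in the class of a reduced word would give a shorter expression. Replacing a factor iji
    by jij would give another reduced expression, but commutations preserve the number of letters
    i. *)
Lemma fc_word_of_fc (w : coxgroup M) : fully_commutative w ->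
  exists2 u, fc_word u & E u = w.
Proof.
move=> fw; have [u uE us] := cox_length_expr w; exists u => // v uv.
have vE : E v = w by rewrite -(comm_eq_eval uv).
have vs : size v = cox_length w by rewrite -(comm_eq_size uv).
split=> [a i b vab|a i j b m vab].
  have := cox_length_le (a ++ b); have /= := cox_eval_cat2 a b (cox_eval_sqr i).
  by rewrite -[_ ++ [:: i, i & b]]vab vE => <-; rewrite -vs vab !size_cat /=; lia.
have := cox_eval_cat2 a b (cox_eval_braid m); rewrite -vab vE => /esym vE'.
have /(fw v _ (conj vE vs))/comm_eq_perm/permP/(_ (pred1 i)) : reduced_expr w (a ++ [:: j; i; j] ++ b).
  by split=> //; rewrite -vs vab !size_cat.
have ij : (j == i) = false by rewrite -(coxm_diag M) coxm_sym m.
by rewrite vab !count_cat /= eqxx ij /=; lia.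
Qed.

End SimplyLacedWords.

(** * Alternating words on a cycle *)

Section Alternation.

Definition neqrel : rel nat := fun x y => x != y.

(* The possible numbers a, b of letters x, y in an alternating word on {x, y},
   where f tells whether the first letter is x. *)
Definition edge_ok a b (f : bool) : bool :=
  if f then (0 < a) && ((a == b) || (a == b.+1)) else (b == a) || (b == a.+1).

(** The default [d] differs from i, so that the empty word gets the label false, as [edge_ok]
    requires when a = 0. *)
Lemma sorted_neq_edge_ok d i j w : i != j -> d != i ->
  all [in [:: i; j]] w -> sorted neqrel w ->
  edge_ok (count_mem i w) (count_mem j w) (head d w == i).
Proof.
move=> ij di; elim: w => [|x w IHw] /=; first by rewrite (negPf di).
move=> /andP[xij wij] pw; have {IHw} := IHw wij (path_sorted pw).
case: w wij pw => [|y w] /= yij pw; rewrite /edge_ok.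
  by move: xij; rewrite !inE; case: ifP; case: ifP; lia.
move: xij yij pw; rewrite /neqrel !inE => xij /andP[yij _] /andP[xy _].
by case: ifP; case: ifP; lia.
Qed.

Lemma sorted_neq_inj d i j w1 w2 : i != j -> d != i ->
  all [in [:: i; j]] w1 -> all [in [:: i; j]] w2 ->
  sorted neqrel w1 -> sorted neqrel w2 -> size w1 = size w2 ->
  (head d w1 == i) = (head d w2 == i) -> w1 = w2.
Proof.
move=> ij di; elim: w1 w2 => [|x w1 IH] [|y w2] //= /andP[xij w1ij] /andP[yij w2ij].
move=> p1 p2 [sw] xy; have {}xy : x = y by move: xij yij xy; rewrite !inE; lia.
rewrite -{y}xy in yij p2 *; congr (_ :: _).
apply: IH => //; [exact: path_sorted p1|exact: path_sorted p2|].
case: w1 w2 w1ij w2ij p1 p2 sw => [|z w1] [|t w2] //=.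
move=> /andP[zij _] /andP[tij _] /andP[xz _] /andP[xt _] _.
by move: xij zij tij xz xt; rewrite !inE /neqrel; lia.
Qed.

Lemma sorted_filter_decomp (T : eqType) (P : pred T) (R : rel T) (s : seq T) :
  (forall a x b y c, s = a ++ x :: b ++ y :: c -> P x -> P y -> ~~ has P b ->
     R x y) ->
  sorted R (filter P s).
Proof.
elim: s => //= x s IHs sR; have {}IHs : sorted R (filter P s).
  by apply: IHs => a y b z c sE; apply: (sR (x :: a) y b z c); rewrite sE.
case Px: (P x) => //=; case Es: (filter P s) IHs => [//|y t] /= ->; rewrite andbT.
have hs : has P s by rewrite has_filter Es.
case: (split_find hs) Es sR => z b c Pz nb Es sR.
have fb : filter P b = [::] by apply/eqP; rewrite -[_ == _]negbK -has_filter.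
move: Es; rewrite cat_rcons filter_cat fb /= Pz => -[<- _].
by apply: (sR [::] x b z c) => //; rewrite cat_rcons.
Qed.

End Alternation.

Section CyclicWords.
Variable N : nat.
Implicit Types (U V : seq nat).

(** Both families are read on a cycle of [N] vertices. A path on n vertices is the cycle on n+1
    vertices whose vertex 0 carries no generator, so [lab] below need not be surjective. *)
Definition nx i := if i.+1 == N then 0 else i.+1.

Definition edge x U := [seq y <- U | y \in [:: x; nx x]].

Definition alternating U := forall x, x < N -> sorted neqrel (edge x U).

(** The default [N] is not a vertex: an edge whose letters do not occur has label false. *)
Definition edge_first x U : bool := head N (edge x U) == x.

Variables (I : finType) (M : coxmatrix I) (lab : I -> nat).
Hypothesis lab_lt : forall i, lab i < N.
Hypothesis lab_inj : injective lab.
Hypothesis M_lab : forall i j, M i j = if i == j then 1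
  else if (nx (lab i) == lab j) || (nx (lab j) == lab i) then 3 else 2.
Hypothesis N_gt1 : forall i : I, 1 < N.
Hypothesis N_gt2 : forall i j : I, i != j -> 2 < N.
Implicit Types (u v : seq I) (i j : I).

Local Notation W := (map lab).

Lemma M_lab_le3 i j : 0 < M i j <= 3.
Proof. by rewrite M_lab; case: ifP => // _; case: ifP. Qed.

Lemma M_lab3 i j : M i j = 3 ->
  i != j /\ ((nx (lab i) == lab j) || (nx (lab j) == lab i)).
Proof. by rewrite M_lab; case: eqP => // _; case: ifP. Qed.

Lemma M_lab_adj i j x : i != j -> lab i \in [:: x; nx x] ->
  lab j \in [:: x; nx x] -> M i j = 3.
Proof.
move=> ij; have lij : lab i != lab j by apply: contra ij => /eqP/lab_inj->.
rewrite M_lab (negPf ij) !inE => ix jx; case: ifP => // /norP[].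
by case/orP: ix => /eqP ix; case/orP: jx => /eqP jx;
  rewrite ix jx ?eqxx // in lij *.
Qed.

Lemma edge_comm u v x : comm_eq M u v -> edge x (W u) = edge x (W v).
Proof.
elim=> [_ _ [a b i j ij]|//|w w' w'' _ -> _ -> //].
rewrite /edge !map_cat !filter_cat /=; congr (_ ++ (_ ++ _)).
have ij' : i != j by rewrite -(coxm_diag M) ij.
by case: ifP => // ix; case: ifP => // jx; rewrite (M_lab_adj ij' ix jx) in ij.
Qed.

Lemma comm_eq_move i a b : (forall j, j \in a -> M i j = 2) ->
  comm_eq M (a ++ i :: b) (i :: a ++ b).
Proof.
elim: a => [|j a IHa] ia /=; first exact: rt_refl.
apply: (@rt_trans _ _ _ (j :: i :: a ++ b)).
  by apply/comm_eq_cons/IHa => k ka; apply: ia; rewrite inE ka orbT.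
by apply: comm_eq_swap; rewrite coxm_sym ia // inE eqxx.
Qed.

(** The first letter i of [u] comes first in every edge that contains it. Hence the letters before
    the first i in [v] commute with i, which can be moved to the front. This is the projection
    property of traces. *)
Lemma comm_eq_of_edges u v :
  (forall x, x < N -> edge x (W u) = edge x (W v)) -> comm_eq M u v.
Proof.
elim: u v => [|i u IHu] v uv.
  case: v uv => [|j v] uv; first exact: rt_refl.
  by have := uv _ (lab_lt j); rewrite /edge /= inE eqxx.
have iv : i \in v.
  have : lab i \in edge (lab i) (W v).
    by rewrite -uv // /edge /= !inE eqxx inE eqxx.
  by rewrite mem_filter => /andP[_]; rewrite mem_map.
have [a [b [vE ia]]] : exists a b, v = a ++ i :: b /\ i \notin a.
  exists (take (index i v) v), (drop (index i v).+1 v); split.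
    by rewrite -{1}(cat_take_drop (index i v) v) (drop_nth i) ?index_mem // nth_index.
  by rewrite in_take_leq ?ltnn // index_size.
have ca : comm_eq M v (i :: a ++ b).
  rewrite vE; apply: comm_eq_move => j ja; rewrite M_lab.
  have ij : i == j = false by apply/eqP => ij; rewrite ij ja in ia.
  have noedge x : x < N -> lab i \in [:: x; nx x] -> lab j \notin [:: x; nx x].
    move=> xN ix; apply/negP => jx; have := uv x xN.
    rewrite vE /edge /= ix map_cat filter_cat.
    have : lab j \in edge x (W a) by rewrite mem_filter jx map_f.
    rewrite -/(edge x (W a)); case Ea: (edge x (W a)) => [//|y t] _ [yE _].
    have : y \in edge x (W a) by rewrite Ea inE eqxx.
    by rewrite mem_filter -yE mem_map // (negPf ia) andbF.
  rewrite ij; case: ifP => // /orP[/eqP e|/eqP e].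
    have := noedge _ (lab_lt i); rewrite !inE eqxx e => /(_ isT).
    by rewrite eqxx orbT.
  have := noedge _ (lab_lt j); rewrite !inE e eqxx orbT => /(_ isT).
  by rewrite eqxx.
apply: rt_trans (comm_eq_sym ca); apply/comm_eq_cons/IHu => x xN.
have := uv x xN; rewrite (edge_comm x ca) /edge /=.
by case: ifP => // _ [].
Qed.

Lemma nx_lt x : x < N -> nx x < N.
Proof. by rewrite /nx; case: eqP; lia. Qed.

Definition px x := if x == 0 then N.-1 else x.-1.

Lemma px_lt x : x < N -> px x < N.
Proof. by rewrite /px; case: eqP; lia. Qed.

Lemma pxK x : x < N -> nx (px x) = x.
Proof. by rewrite /px /nx; case: (eqVneq x 0) => ?; case: eqP; lia. Qed.

Lemma alternating_fc u : alternating (W u) -> fc_word M u.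
Proof.
move=> au v uv; have av x (xN : x < N) : sorted neqrel (edge x (W v)).
  by rewrite -(edge_comm x uv) au.
split=> [a i b vE|a i j b m vE].
  have := av _ (lab_lt i); rewrite vE /edge !map_cat !filter_cat /= !inE eqxx /=.
  by move=> /cat_sorted2[_ /=]; rewrite /neqrel eqxx.
have [ij adj] := M_lab3 m; have N2 := N_gt2 ij.
(* Since N > 2, some edge at i avoids j, and there the two letters i of iji become consecutive. *)
have [x [xN ix jx]] : exists x, [/\ x < N, lab i \in [:: x; nx x] &
    lab j \notin [:: x; nx x]].
  have li := lab_lt i; have lj := lab_lt j.
  case/orP: adj => /eqP e; [exists (px (lab i))|exists (lab i)]; split=> //.
  - exact: px_lt.
  - by rewrite pxK // !inE eqxx orbT.
  - rewrite pxK // !inE -e /px /nx.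
    by case: ((lab i).+1 =P N) => ?; case: (lab i =P 0) => ?; lia.
  - by rewrite inE eqxx.
  - rewrite !inE -e /nx.
    by do ?case: (_.+1 =P N) => ?; lia.
have := av x xN; rewrite vE /edge !map_cat !filter_cat /= ix (negPf jx).
by move=> /cat_sorted2[_ /=]; rewrite /neqrel eqxx.
Qed.

(** If no letter of [b] is adjacent to i, commutations bring the two letters i together; if exactly
    one is, they produce a factor iji. *)
Lemma fc_word_separated u a i b c : fc_word M u -> u = a ++ i :: b ++ i :: c ->
  i \notin b -> exists j1 j2 b1 b2 b3, [/\ b = b1 ++ j1 :: b2 ++ j2 :: b3,
    M i j1 = 3, M i j2 = 3 & forall j, j \in b2 -> M i j = 2].
Proof.
move=> fu uE ib; pose P j := M i j == 3.
have M2 b' : {subset b' <= b} -> ~~ has P b' -> forall j, j \in b' -> M i j = 2.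
  move=> b'b /hasPn nP j jb'; have := nP j jb'; rewrite /P M_lab.
  have -> : i == j = false by apply/eqP => ij; move: ib; rewrite ij b'b.
  by case: ifP.
have mv b' d : {subset b' <= b} -> ~~ has P b' ->
    comm_eq M (i :: b' ++ d) (b' ++ i :: d).
  by move=> b'b nP; apply/comm_eq_sym/comm_eq_move/M2.
case: (boolP (has P b)) => [hb|nb]; last first.
  have cu : comm_eq M u (a ++ b ++ [:: i, i & c]).
    by rewrite uE; apply/comm_eq_catl/mv.
  by have := fc_word_comm cu fu; rewrite catA => /fc_word_no_sqr.
case: (split_find hb) M2 mv ib uE => j1 b1 b' /eqP Pj1 nb1 M2 mv ib uE.
case: (boolP (has P b')) => [hb'|nb'].
  case: (split_find hb') M2 mv ib uE => j2 b2 b3 /eqP Pj2 nb2 M2 mv ib uE.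
  exists j1, j2, b1, b2, b3; split=> //; first by rewrite !cat_rcons.
  by apply: M2 => // j jb2; rewrite !(mem_cat, mem_rcons, inE) jb2 !orbT.
have cu : comm_eq M u ((a ++ b1) ++ [:: i, j1, i & b' ++ c]).
  rewrite uE cat_rcons -!catA; apply/comm_eq_catl.
  apply: rt_trans (mv b1 _ _ nb1) _.
    by move=> j jb1; rewrite mem_cat mem_rcons inE jb1 orbT.
  apply/comm_eq_catl/comm_eq_cons/comm_eq_cons/comm_eq_sym/mv => //.
  by move=> j jb'; rewrite mem_cat jb' orbT.
by have := fc_word_comm cu fu => /(@fc_word_no_iji _ _ M_lab_le3).
Qed.

(* Between two letters i with no y in between there are two letters k, the other
   neighbour of i, with no i in between: infinite descent. *)
Lemma fc_word_descent u a i b c y : fc_word M u -> u = a ++ i :: b ++ i :: c ->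
  y < N -> nx (lab i) = y \/ nx y = lab i -> i \notin b -> y \notin W b -> False.
Proof.
have [k] := ubnP (size b); elim: k a i b c y => // k IH a i b c y bk fu uE yN iy ib yb.
have [j1 [j2 [b1 [b2 [b3 [bE m1 m2 nb2]]]]]] := fc_word_separated fu uE ib.
have [ij1 adj1] := M_lab3 m1; have [ij2 adj2] := M_lab3 m2.
have yj1 : y != lab j1.
  by apply: contra yb => /eqP->; rewrite mem_map // bE mem_cat inE eqxx orbT.
have yj2 : y != lab j2.
  apply: contra yb => /eqP->; rewrite mem_map // bE mem_cat inE mem_cat inE eqxx.
  by rewrite !orbT.
have li := lab_lt i; have l1 := lab_lt j1; have l2 := lab_lt j2.
(* The vertex i has only two neighbours, and one of them is y. *)
have j12 : j1 = j2.
  apply: lab_inj; move: iy adj1 adj2 yj1 yj2; rewrite /nx.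
  by do ?case: (_.+1 =P N) => ?; lia.
rewrite -j12 in bE.
apply: (IH (a ++ i :: b1) j1 b2 (b3 ++ i :: c) (lab i)) => //.
- by move: bk; rewrite bE !size_cat /= size_cat /=; lia.
- by rewrite uE bE -!catA /= -!catA.
- by case/orP: adj1 => /eqP; [right|left].
- by apply/negP => /nb2; rewrite m1.
- rewrite mem_map //; apply: contra ib => ib2.
  by rewrite bE mem_cat inE mem_cat ib2 !orbT.
Qed.

(** A repetition in the word of an edge gives two letters i with neither i nor the other endpoint in
    between, which [fc_word_descent] excludes. *)
Lemma fc_alternating u : fc_word M u -> alternating (W u).
Proof.
move=> fu x xN; rewrite /edge filter_map sorted_map.
apply: sorted_filter_decomp => a i b j c uE /= ix jx nb; rewrite /neqrel.
apply/eqP => /lab_inj ij; rewrite -{j}ij in uE jx.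
have nbx y : y \in [:: x; nx x] -> y \notin W b.
  move=> yx; apply/negP => /mapP[j jb yE]; move/hasPn: nb => /(_ j jb) /=.
  by rewrite -yE yx.
have ib : i \notin b by rewrite -(mem_map lab_inj) nbx.
have [y [yN iy yx]] : exists y, [/\ y < N, nx (lab i) = y \/ nx y = lab i &
    y \in [:: x; nx x]].
  move: ix; rewrite !inE => /orP[]/eqP->; [exists (nx x)|exists x]; split=> //.
  - exact: nx_lt.
  - by left.
  - by rewrite !inE eqxx orbT.
  - by right.
  - by rewrite inE eqxx.
exact: (fc_word_descent fu uE yN iy ib (nbx _ yx)).
Qed.

Lemma nx_neq x : 1 < N -> x < N -> x != nx x.
Proof. by rewrite /nx; case: (x.+1 =P N) => ?; lia. Qed.

Lemma nx_inj x y : x < N -> y < N -> nx x = nx y -> x = y.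
Proof. by rewrite /nx; do 2!case: (_.+1 =P N) => ?; lia. Qed.

Lemma all_edge x U : all [in [:: x; nx x]] (edge x U).
Proof. by apply/allP => y; rewrite mem_filter => /andP[]. Qed.

Lemma count_edge x y U : y \in [:: x; nx x] ->
  count_mem y (edge x U) = count_mem y U.
Proof.
move=> yx; rewrite count_filter; apply: eq_count => z /=.
by case: eqP => // ->; rewrite yx.
Qed.

Lemma size_edge x U : x != nx x ->
  size (edge x U) = count_mem x U + count_mem (nx x) U.
Proof.
move=> xn; elim: U => //= y U IHU; rewrite /edge /= -/(edge x U) !inE.
case: (y =P x) => [->|_] /=; first by rewrite IHU (negPf xn); lia.
by case: (y =P nx x) => _ /=; rewrite IHU; lia.
Qed.

Lemma edge_ok_count u x : alternating (W u) -> x < N ->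
  edge_ok (count_mem x (W u)) (count_mem (nx x) (W u)) (edge_first x (W u)).
Proof.
move=> au xN; case: u au => [|i u] au.
  by rewrite /edge_first /edge /= /edge_ok gtn_eqF.
have xx := nx_neq (N_gt1 i) xN.
rewrite -(@count_edge x x) ?inE ?eqxx // -(@count_edge x (nx x)) ?inE ?eqxx ?orbT //.
apply: sorted_neq_edge_ok => //; first by rewrite gtn_eqF.
  exact: all_edge.
exact: au.
Qed.

(** The first letter of a nonempty word comes first on both of its edges, so these two edges have
    different labels. *)
Lemma edge_first_noncst u : 0 < N -> exists2 x, x < N &
  count_mem x (W u) = 0 \/ edge_first x (W u) != edge_first (nx x) (W u).
Proof.
case: u => [|i u] N0; first by exists 0 => //; left.
have li := lab_lt i; exists (px (lab i)); rewrite ?px_lt //; right.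
rewrite pxK // /edge_first /edge /= pxK // !inE eqxx orbT /= eqxx.
have := nx_neq (N_gt1 i) (px_lt li); rewrite pxK // => /negPf.
by rewrite eq_sym => ->.
Qed.

Lemma sumn_count_lab u : sumn [seq count_mem x (W u) | x <- iota 0 N] = size u.
Proof.
elim: u => [|i u IHu] /=.
  by elim: (iota 0 N) => //= x r ->.
rewrite -IHu -[in RHS]add1n.
have -> : 1 = sumn [seq (lab i == x : nat) | x <- iota 0 N].
  have := count_uniq_mem (lab i) (iota_uniq 0 N).
  rewrite mem_iota lab_lt /= => <-; rewrite -sumn_count.
  by congr sumn; apply: eq_map => x; rewrite /= eq_sym.
by elim: (iota 0 N) => //= x r ->; rewrite addnACA.
Qed.

Definition profile u : seq (nat * bool) :=
  mkseq (fun x => (count_mem x (W u), edge_first x (W u))) N.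

Lemma profile_inj u v : alternating (W u) -> alternating (W v) ->
  profile u = profile v -> comm_eq M u v.
Proof.
move=> au av puv; have E x (xN : x < N) :
    count_mem x (W u) = count_mem x (W v) /\
    edge_first x (W u) = edge_first x (W v).
  have := congr1 (fun s => nth (0, false) s x) puv.
  by rewrite !nth_mkseq // => -[-> ->].
apply: comm_eq_of_edges => x xN.
have N1 : 1 < N \/ u = [::] /\ v = [::].
  case: (u) (v) => [|i ?] [|j ?]; [by right| | |]; left;
  by [apply: (N_gt1 i)|apply: (N_gt1 j)].
case: N1 => [N1|[-> ->//]]; have xx := nx_neq N1 xN.
apply: (@sorted_neq_inj N x (nx x)) => //.
- by rewrite gtn_eqF.
- exact: all_edge.
- exact: all_edge.
- exact: au.
- exact: av.
- by rewrite !size_edge // (E x xN).1 (E _ (nx_lt xN)).1.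
- exact: (E x xN).2.
Qed.

Lemma nx_closed (P : pred nat) : (forall x, x < N -> P x -> P (nx x)) ->
  forall x, x < N -> P x -> forall y, y < N -> P y.
Proof.
move=> Pnx; have up x y : x <= y -> y < N -> P x -> P y.
  elim: y => [|y IHy] xy yN Px; first by move: xy Px; rewrite leqn0 => /eqP->.
  move: xy; rewrite leq_eqVlt => /orP[/eqP<- //|xy].
  have := Pnx y (ltnW yN) (IHy xy (ltnW yN) Px).
  by rewrite /nx (ltn_eqF yN).
move=> x xN Px y yN; have N0 : 0 < N by lia.
apply: (up 0) => //; have := Pnx N.-1; rewrite /nx prednK // eqxx; apply=> //.
by apply: (up x) => //; lia.
Qed.

(** Induction on the number of letters. Unless all heights vanish, some vertex x must come first on
    both of its edges; the word starts with x, and the rest is given by induction. *)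
Lemma profile_realize c (f : nat -> bool) :
  (forall x, x < N -> edge_ok (c x) (c (nx x)) (f x)) ->
  (forall x, x < N -> 0 < c x -> exists i, lab i = x) ->
  (exists2 x, x < N & c x = 0 \/ f x != f (nx x)) ->
  exists2 u, alternating (W u) &
    forall x, x < N -> count_mem x (W u) = c x /\ edge_first x (W u) = f x.
Proof.
have [k] := ubnP (\sum_(x < N) c x); elim: k c f => // k IH c f ck cf clab good.
have f0 x : x < N -> c x = 0 -> f x = false.
  by move=> xN cx; have := cf x xN; rewrite cx /edge_ok; case: (f x).
case: (boolP (all (fun x => c x == 0) (iota 0 N))) => [/allP c0|].
  have {}c0 x : x < N -> c x = 0 by move=> xN; apply/eqP/c0; rewrite mem_iota.
  exists [::] => [x _ //|x xN]; rewrite c0 // f0 ?c0 //=.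
  by rewrite /edge_first /edge /= gtn_eqF.
move=> /allPn[z]; rewrite mem_iota => /andP[_ zN] cz.
(* Otherwise all labels are false. Then the heights weakly increase around the cycle, and a zero
   height forces all of them to vanish. *)
have [p pN /andP[/negPf fp fx]] : exists2 p, p < N & ~~ f p && f (nx p).
  case: (boolP (has (fun p => ~~ f p && f (nx p)) (iota 0 N))) => [/hasP[p]|/hasPn H].
    by rewrite mem_iota => /andP[_ pN] fp; exists p.
  have {}H x : x < N -> ~~ f x -> ~~ f (nx x).
    by move=> xN fx; have := H x; rewrite mem_iota xN fx /=; apply.
  have [x xN xg] := good; have [y yN fy] : exists2 y, y < N & ~~ f y.
    case: xg => [cx|]; first by exists x; rewrite ?f0.
    case fx: (f x); last by exists x; rewrite ?fx.
    by exists (nx x); rewrite ?nx_lt.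
  have fF := @nx_closed (fun x => ~~ f x) H _ yN fy.
  case: xg => [cx|]; last first.
    by rewrite (negPf (fF x xN)) (negPf (fF _ (nx_lt xN))).
  exfalso; move: cz; apply/negP/negPn.
  have cz t : t < N -> (c (nx t) <= 0) -> c t <= 0.
    move=> tN; have := cf t tN; rewrite (negPf (fF t tN)) /edge_ok; lia.
  apply: contraT => cz'; have : 0 < c x; last by rewrite cx.
  apply: (@nx_closed (fun t => 0 < c t) _ z) => //; last by rewrite lt0n.
  by move=> t tN ct; have := cz t tN; lia.
set x := nx p in fx; have xN : x < N := nx_lt pN.
have px' : p != x by apply/eqP => e; rewrite e fx in fp.
have := cf p pN; rewrite fp -/x /edge_ok => cpx.
have := cf x xN; rewrite fx /edge_ok => /andP[cx0 cxn].
have [i li] := clab x xN cx0.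
(* Once the initial x is removed, no x is first on the edge from x, and the edge from p starts with
   p if p occurs at all. *)
pose c' y := if y == x then (c x).-1 else c y.
pose f' y := if y == x then false else if y == p then 0 < c p else f y.
have N1 := N_gt1 i.
have nxx y : y < N -> y != p -> nx y != x.
  by move=> yN; apply: contra => /eqP/(nx_inj yN pN)->.
have [] := IH c' f'.
- rewrite -ltnS; apply: leq_trans ck; rewrite ltnS.
  rewrite (bigD1 (Ordinal xN)) //= [X in _ < X](bigD1 (Ordinal xN)) //=.
  rewrite /c' eqxx -addSn prednK // leq_add2l leq_eqVlt; apply/orP; left.
  by apply/eqP/eq_bigr => j jx; case: eqP => // e; case/eqP: jx; apply: val_inj.
- move=> y yN; rewrite /c' /f'.
  have [->|yx] := eqVneq y x.
    by rewrite eq_sym (negPf (nx_neq N1 xN)) /edge_ok; lia.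
  have [->|yp] := eqVneq y p; first by rewrite eqxx /edge_ok; case: ifP; lia.
  by rewrite (negPf (nxx y yN yp)); apply: cf.
- move=> y yN; rewrite /c'; case: eqP => [-> _|_]; first by exists i.
  exact: clab.
(* The vertex p is a witness: its height is 0, or its label is true while that of x is false. *)
- exists p => //; rewrite /c' /f' (negPf px') eqxx -/x eqxx.
  by case: (c p) => [|m]; [left|right].
move=> u au hu; have edgeE y : edge y (W (i :: u)) =
    if x \in [:: y; nx y] then x :: edge y (W u) else edge y (W u).
  by rewrite /edge /= li.
have edge_p : head N (edge p (W u)) != x.
  have [cp fp'] := hu p pN; have [cx _] := hu x xN.
  case: (posnP (c p)) => [cp0|cp0]; last first.
    by move: fp'; rewrite /edge_first /f' (negPf px') eqxx cp0 => /eqP->.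
  have -> : edge p (W u) = [::]; last by rewrite gtn_eqF.
  apply/size0nil; rewrite size_edge // -/x cp cx /c' (negPf px') eqxx.
  by lia.
have path_neq w : head N w != x -> sorted neqrel w -> path neqrel x w.
  by case: w => //= y w yx ->; rewrite andbT /neqrel eq_sym.
have xe y : y < N -> y != x -> y != p -> x \in [:: y; nx y] = false.
  by move=> yN yx yp; rewrite !inE !(eq_sym x) (negPf yx) (negPf (nxx y yN yp)).
exists (i :: u) => [y yN|y yN].
  rewrite edgeE; have [->|yx] := eqVneq y x.
    rewrite inE eqxx; apply: path_neq; last exact: au.
    by have [_] := hu x xN; rewrite /edge_first /f' eqxx => ->.
  have [->|yp] := eqVneq y p; last by rewrite xe //; apply: au.
  by rewrite !inE eqxx orbT; apply: path_neq => //; apply: au.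
have [cy fy] := hu y yN; split.
  by rewrite /= cy li /c'; have [->|yx] := eqVneq y x; lia.
rewrite /edge_first edgeE; have [->|yx] := eqVneq y x.
  by rewrite inE eqxx /= eqxx.
have [->|yp] := eqVneq y p.
  by rewrite !inE eqxx orbT /= eq_sym (negPf px').
rewrite xe //; move: fy; rewrite /edge_first => ->.
by rewrite /f' (negPf yx) (negPf yp).
Qed.

(** A word is chosen for each profile. By [fc_word_unique] the chosen words have distinct values,
    and by [profile_inj] every element is reached. *)
Lemma card_fc_profiles k (L : seq (seq (nat * bool))) : uniq L ->
  (forall s, s \in L <->
     exists u, [/\ alternating (W u), size u = k & profile u = s]) ->
  #|` fset_set (fc_of_length M k)| = size L.
Proof.
move=> Lu Ls.
have [s|h hP] := @choice _ _ (fun s u => s \in L ->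
    [/\ alternating (W u), size u = k & profile u = s]).
  case: (boolP (s \in L)) => [/Ls[u uP]|_]; first by exists u.
  by exists [::].
rewrite -(size_map (fun s => cox_eval M (h s)) L); apply: perm_size.
have fch s : s \in L -> fc_word M (h s).
  by move=> /hP[a _ _]; apply: alternating_fc.
apply: uniq_perm.
- exact: fset_uniq.
- rewrite map_inj_in_uniq // => s t sL tL est.
  have [_ ss ps] := hP s sL; have [_ st pt] := hP t tL.
  rewrite -ps -pt; apply: (@eq_from_nth _ (0, false)); first by rewrite !size_mkseq.
  have := fc_word_unique M_lab_le3 (fch s sL) est; rewrite ss st => /(_ (leqnn _)) cst x.
  rewrite size_mkseq => xN; rewrite !nth_mkseq // /edge_first (edge_comm x cst).
  by have /permP/(_ (pred1 x)) -> := perm_map lab (comm_eq_perm cst).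
move=> w; rewrite -[_ \in enum_fset _]/(w \in fset_set _).
rewrite in_fset_set; last exact: fc_of_length_finite.
apply/idP/mapP => [/set_mem[fw wk]|[s sL ->]].
  have [u fu uE] := fc_word_of_fc fw.
  have uk : size u = k by rewrite -(fc_word_length M_lab_le3 fu) uE.
  have au := fc_alternating fu.
  have uL : profile u \in L by apply/Ls; exists u.
  exists (profile u) => //; rewrite -uE; have [ah _ ph] := hP _ uL.
  exact/comm_eq_eval/(profile_inj au ah)/esym.
have [_ <- _] := hP s sL.
apply/mem_set; split; first exact/(fc_word_fc M_lab_le3)/fch.
exact/(fc_word_length M_lab_le3)/fch.
Qed.

End CyclicWords.

(** * Walks *)

Section Walks.
Implicit Types (s : seq (nat * bool)).

(* The walks of length n from height a to height b, listing at each step the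
   current height and the label f of the step in the sense of edge_ok. *)
Fixpoint walks n a b : seq (seq (nat * bool)) :=
  if n is m.+1 then
    map (cons (a, false)) (walks m a b ++ walks m a.+1 b) ++
    (if a is a'.+1 then map (cons (a, true)) (walks m a b ++ walks m a' b)
     else [::])
  else if a == b then [:: [::]] else [::].

Lemma mem_map_cons (T : eqType) (x y : T) (t : seq T) (L : seq (seq T)) :
  (x :: t \in map (cons y) L) = (x == y) && (t \in L).
Proof.
apply/mapP/andP => [[t' tL [-> ->]]|[/eqP-> tL]]; first by rewrite eqxx.
by exists t.
Qed.

Lemma mem_walksS n a b c f s :
  reflect ([/\ c = a & exists2 d, edge_ok a d f & s \in walks n d b])
          ((c, f) :: s \in walks n.+1 a b).
Proof.
apply: (iffP idP) => [|[-> [d dok sd]]] /=.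
  rewrite mem_cat; case: a => [|a]; rewrite ?in_nil ?orbF ?mem_map_cons !mem_cat.
    by case/andP => /eqP[-> ->] /orP[] h; split=> //; [exists 0|exists 1].
  case/orP => /andP[/eqP[-> ->]] /orP[] h; split=> //.
  - by exists a.+1 => //; rewrite /edge_ok eqxx.
  - by exists a.+2 => //; rewrite /edge_ok eqxx orbT.
  - by exists a.+1 => //; rewrite /edge_ok eqxx.
  - by exists a => //; rewrite /edge_ok eqxx orbT.
rewrite mem_cat mem_map_cons; move: dok; rewrite /edge_ok; case: f.
  case: a => [//|a] /= /orP[/eqP e|/eqP[e]]; rewrite mem_map_cons eqxx !mem_cat e;
  by rewrite sd ?orbT.
by move=> /orP[]/eqP e; rewrite -e mem_cat sd ?orbT eqxx.
Qed.

Lemma nil_notin_walksS n a b : [::] \in walks n.+1 a b = false.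
Proof.
apply/negbTE; rewrite /= mem_cat; case: a => [|a]; rewrite ?in_nil ?orbF.
  by apply/negP => /mapP[].
by apply/norP; split; apply/negP => /mapP[].
Qed.

Lemma walks_head n a b s : s \in walks n a b -> head b (unzip1 s) = a.
Proof.
case: n s => [|n] [|[c f] s] /=; rewrite ?nil_notin_walksS //.
- by case: eqP => // ->.
- by case: eqP.
- by move=> /mem_walksS[-> _].
Qed.

(** The default [b] of [nth] supplies the end height at index n, so the last step needs no separate
    clause. *)
Lemma mem_walks n a b s : s \in walks n a b <->
  [/\ size s = n, head b (unzip1 s) = a & forall i, i < n ->
    edge_ok (nth b (unzip1 s) i) (nth b (unzip1 s) i.+1) (nth false (unzip2 s) i)].
Proof.
elim: n a s => [|n IHn] a s.
  rewrite /=; case: s => [|p s]; last by case: eqP => _; split=> [//|[]].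
  by case: eqP => [->|ab]; split=> // -[_ /esym].
case: s => [|[c f] s]; first by rewrite nil_notin_walksS; split=> // -[].
split=> [/mem_walksS[-> [d dok sd]]|[/= [ss] ca ok]].
  have sd' := walks_head sd; move/IHn: sd => [ss _ ok]; split=> //=; first by rewrite ss.
  by move=> [_ /=|i /ok //]; rewrite nth0 sd'.
apply/mem_walksS; split=> //; exists (head b (unzip1 s)).
  by have := ok 0 isT; rewrite /= nth0 ca.
by apply/IHn; split=> // i /(ok i.+1).
Qed.

Lemma walks_uniq n a b : uniq (walks n a b).
Proof.
elim: n a => [|n IHn] a /=; first by case: eqP.
have disj d e : d != e -> uniq (walks n d b ++ walks n e b).
  move=> de; rewrite cat_uniq !IHn andbT /=; apply/hasPn => s se; apply/negP => sd.
  by rewrite -(walks_head se) -(walks_head sd) eqxx in de.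
rewrite cat_uniq map_inj_uniq; last by move=> ? ? [].
rewrite disj ?ltn_eqF //=; case: a => [|a] //.
rewrite map_inj_uniq; last by move=> ? ? [].
rewrite disj ?gtn_eqF // andbT; apply/hasPn => s /mapP[s' _ ->]; apply/negP.
by rewrite mem_map_cons xpair_eqE andbF.
Qed.

Definition area s := sumn (unzip1 s).

(** For n > 0 the initial height is at most the area, so starting heights up to k suffice. *)
Definition closed_walks n k : seq (seq (nat * bool)) :=
  [seq s <- flatten [seq walks n a a | a <- iota 0 k.+1] | area s == k].

Lemma closed_walks_uniq n k : 0 < n -> uniq (closed_walks n k).
Proof.
move=> n0; apply: filter_uniq; elim: (iota 0 k.+1) (iota_uniq 0 k.+1) => //= a r IH.
move=> /andP[ar /IH{}IH]; rewrite cat_uniq walks_uniq IH andbT.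
apply/hasPn => s /flattenP[_ /mapP[d dr ->] sd]; apply/negP => sa.
case: n n0 {IH} sd sa => // n _ sd sa.
have := walks_head sd; have := walks_head sa; case: s sa {sd} => [|[c f] s] /=.
  by rewrite nil_notin_walksS.
by move=> _ ca cd; rewrite -ca cd dr in ar.
Qed.

Lemma mem_closed_walks n k s : 0 < n -> s \in closed_walks n k <->
  s \in walks n (head 0 (unzip1 s)) (head 0 (unzip1 s)) /\ area s = k.
Proof.
case: n => // n _; rewrite mem_filter; split.
  move=> /andP[/eqP sk /flattenP[_ /mapP[a _ ->] sa]]; split=> //.
  have := walks_head sa; case: s sa sk => [|[c f] s] /=.
    by rewrite nil_notin_walksS.
  by move=> sa _ ca; rewrite ca in sa *.
move=> [sa <-]; rewrite eqxx; apply/flattenP.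
exists (walks n.+1 (head 0 (unzip1 s)) (head 0 (unzip1 s))) => //.
apply: (map_f (fun a => walks n.+1 a a)); rewrite mem_iota /= ltnS.
by case: s {sa} => [|[c f] s] //; rewrite /area /= leq_addr.
Qed.

Lemma mem_walks_closed n s : 0 < n ->
  s \in walks n (head 0 (unzip1 s)) (head 0 (unzip1 s)) <->
  size s = n /\ forall i, i < n ->
    edge_ok (nth 0 (unzip1 s) i) (nth 0 (unzip1 s) (nx n i)) (nth false (unzip2 s) i).
Proof.
move=> n0; rewrite mem_walks.
have E i a : size s = n -> i < n -> nth a (unzip1 s) i = nth 0 (unzip1 s) i.
  by move=> sn ni; apply: set_nth_default; rewrite size_map sn.
split=> [[sn _ ok]|[sn ok]]; split=> //.
- move=> i ni; have := ok i ni; rewrite E // /nx; case: eqP => [e|ne]; last by rewrite E //; lia.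
  by rewrite [nth _ _ i.+1]nth_default ?nth0 // size_map sn e.
- by case: s sn {E ok} n0 => [<-|].
- move=> i ni; have := ok i ni; rewrite E // /nx; case: eqP => [e|ne]; last by rewrite E //; lia.
  by rewrite [nth _ _ i.+1]nth_default ?nth0 // size_map sn e.
Qed.

(* Reading a cyclic walk with positive heights and constant labels as a
   precedence relation on letters would give a directed cycle. *)
Definition acyclic_walk s := has (fun p => p.1 == 0) s || ~~ constant (unzip2 s).

Lemma acyclic_walkP n s : size s = n -> 0 < n -> reflect
  (exists2 x, x < n & nth 0 (unzip1 s) x = 0 \/
     nth false (unzip2 s) x != nth false (unzip2 s) (nx n x))
  (acyclic_walk s).
Proof.
move=> sn n0; apply: (iffP orP) => [[/(has_nthP (0, false))[x]|]|[x xn [x0|xx]]].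
- rewrite sn => xn /eqP x0; exists x => //; left.
  by rewrite (nth_map (0, false)) ?sn.
- move=> ncst; apply: contrapT => nex; case/negP: ncst; apply/(constantP false).
  have H x : x < n -> nth false (unzip2 s) x = nth false (unzip2 s) (nx n x).
    move=> xn; apply/eqP/negPn/negP => xx; apply: nex; exists x => //; by right.
  exists (nth false (unzip2 s) 0); apply: (@eq_from_nth _ false); rewrite ?size_nseq //.
  move=> x; rewrite size_map sn => xn; rewrite nth_nseq ?size_map ?sn xn; apply/eqP.
  apply: (@nx_closed n (fun t => nth false (unzip2 s) t == nth false (unzip2 s) 0) _ 0) => //.
  by move=> t tn; rewrite -H.
- left; apply/(has_nthP (0, false)); exists x; rewrite ?sn //.
  by rewrite -(nth_map _ 0 fst) ?sn // x0.
right; apply: contra xx => /(constantP false)[f ->].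
by rewrite !nth_nseq size_map sn xn nx_lt.
Qed.

(** Constant labels make the heights monotone around the cycle, hence constant. *)
Lemma cyclic_walk_nseq n s : 0 < n ->
  s \in walks n (head 0 (unzip1 s)) (head 0 (unzip1 s)) -> ~~ acyclic_walk s ->
  exists a f, 0 < a /\ s = nseq n (a, f).
Proof.
move=> n0 /(mem_walks_closed _ n0)[sn ok] /norP[s0 /negPn/(constantP false)[f sf]].
have fE x : x < n -> nth false (unzip2 s) x = f.
  by move=> xn; rewrite sf nth_nseq size_map sn xn.
set c := fun x => nth 0 (unzip1 s) x.
have mono : (forall x, x < n -> c (nx n x) <= c x) \/
            (forall x, x < n -> c x <= c (nx n x)).
  case: (f) fE => fE; [left|right] => x xn; have := ok x xn; rewrite fE // /edge_ok -!/(c _);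
  by lia.
have cE x y : x < n -> y < n -> c x <= c y.
  move=> xn yn; case: mono => m.
    apply: (@nx_closed n (fun t => c t <= c y) _ y) => // t tn.
    by apply: leq_trans; apply: m.
  apply: (@nx_closed n (fun t => c x <= c t) _ x) => // t tn h.
  exact: leq_trans h (m t tn).
exists (c 0), f; split.
  rewrite lt0n; apply: contra s0 => c0; apply/(has_nthP (0, false)).
  by exists 0; rewrite ?sn // -(nth_map _ 0 fst) ?sn.
apply: (@eq_from_nth _ (0, false)); rewrite sn ?size_nseq // => x xn.
rewrite nth_nseq xn; apply/eqP; rewrite [nth _ _ x]surjective_pairing xpair_eqE.
rewrite -(nth_map _ 0 fst) ?sn // -(nth_map _ false snd) ?sn // fE // eqxx andbT.
by rewrite eqn_leq !cE.
Qed.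

(** By [cyclic_walk_nseq] the height is the positive integer k / n, and there are two choices of
    label. *)
Lemma size_cyclic_walks n k : 0 < n ->
  size [seq s <- closed_walks n k | ~~ acyclic_walk s] =
  if (n %| k) && (0 < k) then 2 else 0.
Proof.
move=> n0; have memE s : (s \in [seq s <- closed_walks n k | ~~ acyclic_walk s]) <->
    exists a f, [/\ 0 < a, s = nseq n (a, f) & n * a = k].
  rewrite mem_filter; split=> [/andP[ns /(mem_closed_walks _ _ n0)[sw <-]]|[a [f [a0 -> <-]]]].
    have [a [f [a0 sE]]] := cyclic_walk_nseq n0 sw ns; exists a, f; split=> //.
    by rewrite sE /area /unzip1 map_nseq sumn_nseq mulnC.
  apply/andP; split.
    apply/norP; split; first by rewrite has_nseq /= (gtn_eqF a0) andbF.
    by apply/negPn/(constantP false); exists f; rewrite /unzip2 map_nseq size_nseq.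
  apply/mem_closed_walks => //; split; last first.
    by rewrite /area /unzip1 map_nseq sumn_nseq mulnC.
  apply/mem_walks_closed => //; split=> [|x xn]; first by rewrite size_nseq.
  rewrite /unzip1 /unzip2 !map_nseq !nth_nseq xn nx_lt //= /edge_ok eqxx a0.
  by case: (f).
set L := filter _ _ in memE *; have Lu : uniq L by apply/filter_uniq/closed_walks_uniq.
case: ifP => [/andP[nk k0]|nk].
  have -> : 2 = size [:: nseq n (k %/ n, false); nseq n (k %/ n, true)] by [].
  apply/perm_size/uniq_perm => //.
    by case: (n) n0 => // m _; rewrite /= inE eqseq_cons xpair_eqE andbF.
  move=> s; rewrite !inE; apply/idP/idP => [/memE[a [f [a0 -> <-]]]|].
    by rewrite mulKn //; case: f; rewrite eqxx ?orbT.
  have kn : n * (k %/ n) = k by rewrite mulnC divnK.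
  have kn0 : 0 < k %/ n by rewrite divn_gt0 // dvdn_leq.
  by case/orP => /eqP->; apply/memE; exists (k %/ n); [exists false|exists true].
case: L memE {Lu} => // s L /(_ s)[+ _]; rewrite inE eqxx => /(_ isT)[a [f [a0 _ e]]].
by move: nk; rewrite -e dvdn_mulr // muln_gt0 n0 a0.
Qed.

End Walks.

(** * Fully commutative elements as closed walks *)

Definition supported_on (A : pred nat) (s : seq (nat * bool)) :=
  all (fun x => (nth 0 (unzip1 s) x == 0) || A x) (iota 0 (size s)).

(** A word is sent to its profile. The conditions on the walk are necessary by [edge_ok_count] and
    [edge_first_noncst], and sufficient by [profile_realize]; a vertex without generator has height
    0. *)
Lemma card_fc_walks (N : nat) (I : finType) (M : coxmatrix I) (lab : I -> nat) k :
  0 < N -> (forall i, lab i < N) -> injective lab ->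
  (forall i j, M i j = if i == j then 1
     else if (nx N (lab i) == lab j) || (nx N (lab j) == lab i) then 3 else 2) ->
  (I -> 1 < N) -> (forall i j : I, i != j -> 2 < N) ->
  #|` fset_set (fc_of_length M k)| = size [seq s <- closed_walks N k |
     acyclic_walk s && supported_on [in codom lab] s].
Proof.
move=> N0 lab_lt lab_inj M_lab N1 N2.
have unzip1_profile u : unzip1 (profile N lab u) =
    [seq count_mem x (map lab u) | x <- iota 0 N].
  by rewrite /unzip1 /profile /mkseq -map_comp.
have area_profile u : area (profile N lab u) = size u.
  by rewrite /area unzip1_profile sumn_count_lab.
apply: (card_fc_profiles lab_lt lab_inj M_lab N1 N2).
  exact/filter_uniq/closed_walks_uniq.
move=> s; rewrite mem_filter; split.
  move=> /andP[/andP[ac /allP supp] /(mem_closed_walks _ _ N0)[sw sk]].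
  move/(mem_walks_closed _ N0): (sw) => [sN ok].
  move/(acyclic_walkP sN N0): ac => ac.
  have [|u au hu] := @profile_realize N _ lab N1 _ _ ok _ ac.
    move=> x xN; have := supp x; rewrite mem_iota sN => /(_ xN).
    by case: eqP => [->//|_] /codomP[i ->] _; exists i.
  have us : profile N lab u = s.
    apply: (@eq_from_nth _ (0, false)); rewrite size_mkseq ?sN // => x xN.
    have [cE fE] := hu x xN; rewrite nth_mkseq // cE fE.
    by rewrite (nth_map (0, false)) ?sN // (nth_map (0, false)) ?sN // -surjective_pairing.
  by exists u; split=> //; rewrite -sk -us area_profile.
move=> [u [au uk <-]]; have sN : size (profile N lab u) = N by rewrite size_mkseq.
have cE x : x < N -> nth 0 (unzip1 (profile N lab u)) x = count_mem x (map lab u).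
  by move=> xN; rewrite unzip1_profile (nth_map 0) ?size_iota // nth_iota.
have fE x : x < N -> nth false (unzip2 (profile N lab u)) x = edge_first N x (map lab u).
  move=> xN; rewrite /unzip2 /profile /mkseq -map_comp (nth_map 0) ?size_iota //.
  by rewrite nth_iota.
apply/andP; split.
  apply/andP; split.
    apply/(acyclic_walkP sN N0).
    have [x xN xP] := edge_first_noncst lab_lt N1 u N0.
    by exists x => //; rewrite cE // !fE ?nx_lt.
  apply/allP => x; rewrite mem_iota sN => /andP[_ xN]; rewrite cE // -implyNb.
  by apply/implyP; rewrite -lt0n -has_count has_pred1 => /mapP[i _ ->]; apply: codom_f.
apply/mem_closed_walks => //; split; last by rewrite area_profile.
apply/mem_walks_closed => //; split=> // x xN.
by rewrite !cE ?nx_lt // fE //; apply: edge_ok_count.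
Qed.

Lemma nxE N x : x < N -> nx N x = x.+1 %% N.
Proof.
by rewrite /nx; case: eqP => [->|ne xN]; rewrite ?modnn // modn_small //; lia.
Qed.

(** Vertex 0 of the cycle on n+1 vertices carries no generator. The support condition therefore says
    that the walk starts at height 0, and such a walk is acyclic. *)
Lemma card_fc_coxA n k : #|` fset_set (fc_of_length (coxA n) k)| =
  size [seq s <- walks n.+1 0 0 | area s == k].
Proof.
rewrite (@card_fc_walks n.+1 _ (coxA n) (fun i => i.+1)) //; last first.
- by move=> i j /eqP ij; have := ltn_ord i; have := ltn_ord j; case: n i j ij => [|[|n]] // i j [];
  rewrite !ord1.
- by move=> [i ni]; lia.
- move=> i j; rewrite /= /simply_laced; case: eqP => // _.
  have ni := ltn_ord i; have nj := ltn_ord j.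
  rewrite /path_adj /nx; congr (if _ then _ else _).
  by case: (i.+2 =P n.+1) => ?; case: (j.+2 =P n.+1) => ?; lia.
- by move=> i j [] /val_inj.
- by move=> i; rewrite ltnS.
apply/perm_size/uniq_perm => [||s].
- exact/filter_uniq/closed_walks_uniq.
- exact/filter_uniq/walks_uniq.
rewrite (mem_filter _ s (closed_walks _ _)) (mem_filter _ s (walks _ _ _)).
apply/idP/idP.
  move=> /andP[/andP[_ /allP supp] /(mem_closed_walks _ _ (ltn0Sn n))[sw ->]]; rewrite eqxx.
  suff s0 : head 0 (unzip1 s) = 0 by rewrite s0 in sw.
  move/(mem_walks_closed _ (ltn0Sn n)): sw => [sn _].
  have := supp 0; rewrite mem_iota sn /= => /(_ isT) /orP[/eqP|/codomP[//]].
  by rewrite nth0.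
move=> /andP[/eqP sk sw]; have s0 := walks_head sw.
have sw' : s \in walks n.+1 (head 0 (unzip1 s)) (head 0 (unzip1 s)) by rewrite s0.
move/(mem_walks_closed _ (ltn0Sn n)): (sw') => [sn _].
apply/andP; split; last by apply/mem_closed_walks.
apply/andP; split.
  by apply/(acyclic_walkP sn (ltn0Sn n)); exists 0 => //; left; rewrite nth0.
apply/allP => -[|x]; rewrite mem_iota sn => /andP[_ xn].
  by rewrite nth0 s0.
apply/orP; right; apply/codomP.
by exists (Ordinal (xn : x < n)).
Qed.

Lemma card_fc_coxcycle n k : 2 < n ->
  #|` fset_set (fc_of_length (coxcycle n) k)| +
  (if (n %| k) && (0 < k) then 2 else 0) = size (closed_walks n k).
Proof.
move=> n2; have n0 : 0 < n by lia.
rewrite (@card_fc_walks n _ (coxcycle n) (@nat_of_ord n)) //; last first.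
- by move=> _; lia.
- by move=> i j; rewrite /= /simply_laced /cycle_adj !nxE.
- exact: val_inj.
rewrite -size_cyclic_walks // -(count_predC acyclic_walk (closed_walks n k)).
rewrite -!(size_filter _ (closed_walks n k)); congr (_ + _).
 congr size; apply: eq_in_filter => s.
move=> /(mem_closed_walks _ _ n0)[/(mem_walks_closed _ n0)[sn _] _].
rewrite [X in _ && X](_ : _ = true) ?andbT //; apply/allP => x; rewrite mem_iota sn => /andP[_ xn].
by apply/orP; right; apply/codomP; exists (Ordinal xn).
Qed.

(** * The infinite dihedral group *)

Section InfiniteDihedral.
Local Notation M := coxDinfty.
Local Notation E := (cox_eval M).

Definition dletter (b : bool) : 'I_2 := if b then ord_max else ord0.

Lemma dletterK (x : 'I_2) : dletter (x == ord_max) = x.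
Proof. by apply: val_inj; case: x => [[|[|]]]. Qed.

Fixpoint altword b k : seq 'I_2 :=
  if k is m.+1 then dletter b :: altword (~~ b) m else [::].

Lemma size_altword b k : size (altword b k) = k.
Proof. by elim: k b => //= k IHk b; rewrite IHk. Qed.

Lemma sorted_altword (v : seq 'I_2) : sorted (fun x y => x != y) v ->
  v = altword (head ord0 v == ord_max) (size v).
Proof.
elim: v => //= x v IHv xv; rewrite dletterK; congr (_ :: _).
rewrite {1}(IHv (path_sorted xv)); case: v xv {IHv} => //= y v /andP[xy _].
suff -> : (y == ord_max) = ~~ (x == ord_max) by [].
by move: xy; rewrite -{1}(dletterK x) -{1}(dletterK y); do 2!case: (_ == ord_max).
Qed.

(** The generators act on the line as the reflections at 0 and at 1/2. *)
Definition dreflect (x : 'I_2) (y : int) : int := (Posz x - y)%R.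

Lemma dreflect_altword b k : foldr dreflect 0%R (altword b k) =
  if b then Posz (uphalf k) else (- Posz (k./2))%R.
Proof.
elim: k b => [|k IHk] b /=; first by case: b.
by rewrite IHk /dreflect; case: b => /=; lia.
Qed.

(** The image of 0 on the line has its sign given by [b] and determines k up to parity, which is a
    second invariant. Only for k = 0 does [b] remain undetermined. *)
Lemma altword_inj b k b' k' : E (altword b k) = E (altword b' k') ->
  altword b k = altword b' k'.
Proof.
have rel1 (T : Type) (act : 'I_2 -> T -> T) : (forall i, involutive (act i)) ->
    forall i j y, iter (M i j) (act i \o act j) y = y.
  by move=> actK i j y; rewrite /= /dihedral_infty; case: eqP => // ->; apply: actK.
have odd_foldr (u : seq 'I_2) : foldr (fun=> negb) false u = odd (size u).
  by elim: u => //= x u ->.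
have dK i : involutive (dreflect i) by move=> y; rewrite /dreflect; lia.
move=> e; have := cox_rep (rel1 _ _ dK) e 0%R.
have := cox_rep (rel1 _ (fun=> negb) (fun=> negbK)) e false.
rewrite !odd_foldr !size_altword !dreflect_altword => okk' H.
have [[-> ->//] | [k0 k'0]] : (b, k) = (b', k') \/ k = 0 /\ k' = 0; last by rewrite k0 k'0.
  by move: H; case: (b); case: (b') => H; [left; congr pair| | |left; congr pair]; lia.
Qed.

Lemma dihedral_reduced (v : seq 'I_2) : size v = cox_length (E v) ->
  v = altword (head ord0 v == ord_max) (size v).
Proof.
move=> vr; apply: sorted_altword; rewrite -[v]filter_predT.
apply: sorted_filter_decomp => a x [|? ?] y c //= vE _ _ _; apply/eqP => xy.
have := cox_length_le M (a ++ c); have := cox_eval_cat2 a c (cox_eval_sqr M x).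
rewrite /= {2}xy -vE => <-; rewrite -vr vE !size_cat /=; lia.
Qed.

Lemma altword_length b k : cox_length (E (altword b k)) = k.
Proof.
have [v vE vs] := cox_length_expr (E (altword b k)).
have vr : size v = cox_length (E v) by rewrite vE.
move: vE; rewrite {1}(dihedral_reduced vr) => /altword_inj.
by rewrite -(dihedral_reduced vr) -vs => ->; rewrite size_altword.
Qed.

Lemma card_fc_dihedral k :
  #|` fset_set (fc_of_length M k)| = if k == 0 then 1 else 2.
Proof.
pose L := if k == 0 then [:: [::]] else [:: altword false k; altword true k].
have Lu : uniq L.
  rewrite /L; case: (k) => //= m; rewrite inE andbT; apply/eqP => -[].
have -> : (if k == 0 then 1 else 2) = size L by rewrite /L; case: eqP.
rewrite -(size_map E L); apply/perm_size/uniq_perm.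
- exact: fset_uniq.
- rewrite map_inj_in_uniq // => u v; rewrite /L; case: eqP => _.
    by rewrite !inE => /eqP-> /eqP->.
  by rewrite !inE => /orP[]/eqP-> /orP[]/eqP-> /altword_inj.
move=> w; rewrite -[_ \in enum_fset _]/(w \in fset_set _).
rewrite in_fset_set; last exact: fc_of_length_finite.
apply/idP/mapP => [/set_mem[_ wk]|[u uL ->]].
  have [v vE vs] := cox_length_expr w; exists v => //.
  rewrite (@dihedral_reduced v) ?vE // vs wk /L; case: (k =P 0) => [-> //|_].
  by case: (_ == _); rewrite !inE eqxx ?orbT.
have [b ->] : exists b, u = altword b k.
  move: uL; rewrite /L; case: eqP => [->|_]; rewrite !inE; first by move=> /eqP->; exists true.
  by case/orP => /eqP->; [exists false|exists true].
apply/mem_set; split; last exact: altword_length.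
move=> u' v' [u'E u's] [v'E v's].
have -> : u' = v'; last exact: rt_refl.
rewrite (@dihedral_reduced u') ?u'E // (@dihedral_reduced v') ?v'E //.
by apply: altword_inj; rewrite -!dihedral_reduced ?u'E ?v'E.
Qed.

End InfiniteDihedral.

(** For k > 0 the heights are the two halves of k, the labels are opposite and the larger height has
    label true; the two rotations are the two alternating words. *)
Lemma size_acyclic_walks2 k :
  size [seq s <- closed_walks 2 k | acyclic_walk s] = if k == 0 then 1 else 2.
Proof.
pose L := if k == 0 then [:: [:: (0, false); (0, false)]] else
  [:: [:: (uphalf k, true); (k./2, false)]; [:: (k./2, false); (uphalf k, true)]].
have -> : (if k == 0 then 1 else 2) = size L by rewrite /L; case: eqP.
apply/perm_size/uniq_perm.
- exact/filter_uniq/closed_walks_uniq.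
- by rewrite /L; case: eqP => //= _; rewrite inE !eqseq_cons !xpair_eqE !andbF.
move=> s; rewrite (mem_filter _ s (closed_walks _ _)); apply/idP/idP.
  move=> /andP[ac /(@mem_closed_walks 2 k s isT)[/(@mem_walks_closed 2 s isT)[s2 ok] sk]].
  case: s s2 ok sk ac => [|[c0 f0] [|[c1 f1] []]] // _ ok.
  have := ok 0 isT; have /= := ok 1 isT; rewrite /area /acyclic_walk /= /edge_ok /L.
  move=> ok1 ok0 sk {ok}; case: (k =P 0) => [k0|kn0]; rewrite !inE !eqseq_cons !xpair_eqE ?eqxx.
    by case: f0 f1 ok1 ok0 => [] []; rewrite /= ?eqxx; lia.
  by case: f0 f1 ok1 ok0 => [] []; rewrite /= ?eqxx; lia.
move=> sL; have sE : exists c0 f0 c1 f1, s = [:: (c0, f0); (c1, f1)] /\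
    [/\ edge_ok c0 c1 f0, edge_ok c1 c0 f1, c0 + c1 = k & (c0 == 0) || (f0 != f1)].
  move: sL; rewrite /L; case: eqP => [->|kn0]; rewrite !inE.
    by move=> /eqP->; exists 0, false, 0, false.
  case/orP => /eqP->; [exists (uphalf k), true, k./2, false|
    exists k./2, false, (uphalf k), true]; split=> //; split; rewrite /edge_ok; lia.
have [c0 [f0 [c1 [f1 [-> [ok0 ok1 sk ac]]]]]] := sE; apply/andP; split.
  rewrite /acyclic_walk /= andbT; move: ac; case: (c0 =P 0) => //= _.
  by rewrite eq_sym => ->; rewrite orbT.
apply/mem_closed_walks => //; split; last by rewrite /area /= addn0.
by apply/mem_walks_closed => //; split=> // -[|[|]].
Qed.

Lemma card_fc_coxDinfty k : #|` fset_set (fc_of_length coxDinfty k)| +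
  (if (2 %| k) && (0 < k) then 2 else 0) = size (closed_walks 2 k).
Proof.
rewrite card_fc_dihedral -size_acyclic_walks2 -size_cyclic_walks //.
by rewrite -(count_predC acyclic_walk (closed_walks 2 k)) !(size_filter _ (closed_walks 2 k)).
Qed.

(** Only the walk resting at height 0 is acyclic, in agreement with the convention that the series
    of affine A_0 is 1. *)
Lemma size_closed_walks1 k :
  (k == 0) + (if (1 %| k) && (0 < k) then 2 else 0) = size (closed_walks 1 k).
Proof.
rewrite -size_cyclic_walks // -(count_predC acyclic_walk (closed_walks 1 k)).
rewrite -!(size_filter _ (closed_walks 1 k)); congr (_ + _).
pose L := if k == 0 then [:: [:: (0, false)]] else [::].
have -> : nat_of_bool (k == 0) = size L by rewrite /L; case: eqP.
apply/perm_size/uniq_perm; first by rewrite /L; case: eqP.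
  exact/filter_uniq/closed_walks_uniq.
move=> s; rewrite (mem_filter _ s (closed_walks _ _)); apply/idP/idP; last first.
  move=> /andP[ac /(@mem_closed_walks 1 k s isT)[/(@mem_walks_closed 1 s isT)[s2 ok] sk]].
  case: s s2 ok sk ac => [|[c0 f0] []] // _ ok; have := ok 0 isT.
  rewrite /area /acyclic_walk /= !orbF /edge_ok /L addn0 => ok0 <- /eqP c0E.
  by move: ok0; rewrite c0E inE; case: f0 {ok}.
rewrite /L; case: eqP => // ->; rewrite inE => /eqP->.
by apply/andP; split=> //; apply/mem_closed_walks => //; split=> //; apply/mem_walks_closed => //; split=> // -[].
Qed.

(** * Formal power series *)

Local Open Scope ring_scope.

Section FpsComplements.
Variable R : comUnitRingType.
Implicit Types (f g : fps R) (q : R) (F : nat -> fps R).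

Lemma coef_fpsD f g n : (f + g) n = f n + g n.
Proof. by []. Qed.

Lemma coef_fpsN f n : (- f) n = - f n.
Proof. by []. Qed.

Lemma coef_fps1 n : (1 : fps R) n = (n == 0%N)%:R.
Proof. by case: n. Qed.

Lemma coef_fpsCM q f n : (fpsC q * f) n = q * f n.
Proof.
rewrite coef_fpsM big_ord_recl subn0 big1 ?addr0 // => i _.
by rewrite /= mul0r.
Qed.

Lemma coef_fpsXM f n : (fpsX * f) n = if n is m.+1 then f m else 0.
Proof.
rewrite coef_fpsM; case: n => [|n]; first by rewrite big_ord1 mul0r.
rewrite !big_ord_recl big1 => [|i _]; last by rewrite mul0r.
by rewrite /= mul0r add0r mul1r addr0 subn1.
Qed.

Fact fpsC_is_zmod_morphism : zmod_morphism (@fpsC R).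
Proof. by move=> x y; apply: fpsP => -[|n] //=; rewrite subr0. Qed.

Fact fpsC_is_monoid_morphism : monoid_morphism (@fpsC R).
Proof.
split=> // x y; apply: fpsP => n; rewrite coef_fpsCM.
by case: n => //= n; rewrite mulr0.
Qed.

HB.instance Definition _ := GRing.isZmodMorphism.Build _ _ (@fpsC R) fpsC_is_zmod_morphism.
HB.instance Definition _ := GRing.isMonoidMorphism.Build _ _ (@fpsC R) fpsC_is_monoid_morphism.

Definition fps_euler f : fps R := Fps (fun n => f n *+ n).

Lemma fpsX_deriv f : fpsX * fps_deriv f = fps_euler f.
Proof. by apply: fpsP => n; rewrite coef_fpsXM; case: n. Qed.

Lemma fps_eulerM f g : fps_euler (f * g) = fps_euler f * g + f * fps_euler g.
Proof.
apply: fpsP => n; rewrite coef_fpsD !coef_fpsM /= -big_split /= -sumrMnl.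
apply: eq_bigr => i _; rewrite mulrnAl mulrnAr -mulrnDr subnKC //.
by rewrite -ltnS.
Qed.

(** The substitution of q x for x. *)
Definition fps_dil q f : fps R := Fps (fun n => q ^+ n * f n).

Fact fps_dil_is_zmod_morphism q : zmod_morphism (fps_dil q).
Proof. by move=> f g; apply: fpsP => n; exact: mulrBr. Qed.

Fact fps_dil_is_monoid_morphism q : monoid_morphism (fps_dil q).
Proof.
split; first by apply: fpsP => -[|n] //=; rewrite ?mulr1 ?mulr0.
move=> f g; apply: fpsP => n /=; rewrite mulr_sumr; apply: eq_bigr => i _.
rewrite mulrACA -exprD subnKC //.
by rewrite -ltnS.
Qed.

HB.instance Definition _ q :=
  GRing.isZmodMorphism.Build _ _ (fps_dil q) (fps_dil_is_zmod_morphism q).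
HB.instance Definition _ q :=
  GRing.isMonoidMorphism.Build _ _ (fps_dil q) (fps_dil_is_monoid_morphism q).

Lemma fps_dilC q c : fps_dil q (fpsC c) = fpsC c.
Proof. by apply: fpsP => -[|n] /=; rewrite ?mul1r ?mulr0. Qed.

Lemma fps_dilX q : fps_dil q fpsX = fpsX * fpsC q.
Proof.
by apply: fpsP => n; rewrite mulrC coef_fpsCM; case: n => [|[|n]] /=; rewrite ?mulr0 ?expr1.
Qed.

Lemma fps_dil_sum q (F : nat -> fps R) :
  fps_dil q (fps_sum F) = fps_sum (fun k => fps_dil q (F k)).
Proof. by apply: fpsP => n /=; rewrite mulr_sumr. Qed.

Lemma fps_euler_dil q f : fps_euler (fps_dil q f) = fps_dil q (fps_euler f).
Proof. by apply: fpsP => n /=; rewrite mulrnAr. Qed.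

Lemma fps_unitM0 f : f 0%N = 1 -> f \is a GRing.unit.
Proof. by rewrite fps_unitE => ->; apply: unitr1. Qed.

Definition fps_small (F : nat -> fps R) := forall k n, (n < k)%N -> F k n = 0.

Lemma fps_smallM f F : fps_small F -> fps_small (fun k => f * F k).
Proof.
move=> F0 k n nk; rewrite coef_fpsM big1 // => i _.
by rewrite F0 ?mulr0 // (leq_ltn_trans (leq_subr _ _)).
Qed.

Lemma fps_smallB F (F' : nat -> fps R) :
  fps_small F -> fps_small F' -> fps_small (fun k => F k - F' k).
Proof. by move=> F0 F'0 k n nk; rewrite coef_fpsD coef_fpsN F0 ?F'0 ?subrr. Qed.

Lemma fps_sumM f F : fps_small F -> f * fps_sum F = fps_sum (fun k => f * F k).
Proof.
move=> F0; apply: fpsP => n; transitivity ((f * \sum_(k < n.+1) F k) n).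
  rewrite !coef_fpsM; apply: eq_bigr => i _; congr (_ * _).
  by apply: fps_sum_stable => //; rewrite ltnS leq_subr.
by rewrite mulr_sumr coef_fps_sum.
Qed.

Lemma fps_sumB F (F' : nat -> fps R) : fps_sum F - fps_sum F' = fps_sum (fun k => F k - F' k).
Proof. by apply: fpsP => n; rewrite coef_fpsD coef_fpsN /= sumrB. Qed.

Lemma fps_sumS F : fps_small F ->
  fps_sum F = F 0%N + fps_sum (fun k => F k.+1).
Proof.
move=> F0; apply: fpsP => n; rewrite coef_fpsD [fps_sum F n](@fps_sum_stable _ _ n.+2) //.
by rewrite coef_fps_sum big_ord_recl.
Qed.

Lemma eq_fps_sum F (F' : nat -> fps R) : F =1 F' -> fps_sum F = fps_sum F'.
Proof. by move=> FF'; apply: fpsP => n /=; apply: eq_bigr => k _; rewrite FF'. Qed.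

Lemma fps_smallMl (g : nat -> fps R) F :
  fps_small F -> fps_small (fun k => g k * F k).
Proof. by move=> F0 k n nk; rewrite (@fps_smallM (g k) F). Qed.

Lemma fps_sum_qdiff (q : fps R) F : fps_small F ->
  fps_sum F - fps_sum (fun n => q ^+ n * F n) =
  fps_sum (fun n => (1 - q ^+ n.+1) * F n.+1).
Proof.
move=> F0; rewrite fps_sumB fps_sumS; last exact/fps_smallB/fps_smallMl.
rewrite expr0 mul1r subrr add0r; apply: eq_fps_sum => n.
by rewrite mulrBl mul1r.
Qed.

End FpsComplements.

(** * Weighted walks and the cut at height 0 *)

Section WalkSeries.
Variable R : comUnitRingType.
Implicit Types (q l : R) (f : nat -> R).

(** The transfer operator of the walks. The parameter [l] counts the labels of a level step at
    height 0: it is 1 for the original walks, and 2 for walks lowered by one from positive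
    heights. *)
Definition walk_step q l f (a : nat) : R :=
  q ^+ a * ((if a is a'.+1 then f a' + 2 * f a else l * f 0%N) + f a.+1).

Definition walk_wt q l n a b : R :=
  iter n (walk_step q l) (fun c => (c == b)%:R) a.

Arguments walk_wt : simpl never.

Lemma walk_wtS q l n a b :
  walk_wt q l n.+1 a b = walk_step q l (fun c => walk_wt q l n c b) a.
Proof. by []. Qed.

Lemma walk_wt_far q l n a b : (b + n < a)%N -> walk_wt q l n a b = 0.
Proof.
elim: n a => [|n IHn] a; first by rewrite addn0 /walk_wt /=; case: ltngtP.
rewrite addnS walk_wtS /walk_step; case: a => [//|a] ba.
by rewrite !IHn ?(mulr0, addr0) //; lia.
Qed.

(** Walks are cut after i steps; the bound [B] exceeds every height that can be reached by then. *)
Lemma walk_wt_comp q l B i j a b : (a + i < B)%N ->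
  \sum_(c < B) walk_wt q l i a c * walk_wt q l j c b = walk_wt q l (i + j) a b.
Proof.
elim: i a => [|i IHi] a aB.
  rewrite (bigD1 (Ordinal (leq_ltn_trans (leq_addr 0 a) aB))) //= big1 => [|c ca].
    by rewrite /walk_wt /= eqxx mul1r addr0.
  rewrite {1}/walk_wt /=; case: eqP => [e|_]; last by rewrite mul0r.
  by case/eqP: ca; apply: val_inj.
rewrite addSn walk_wtS /walk_step -!IHi; try lia.
case: a aB => [|a] aB; rewrite -?IHi; try lia.
  rewrite mulr_sumr -big_split mulr_sumr /=; apply: eq_bigr => c _.
  by rewrite walk_wtS /walk_step; ring.
rewrite mulr_sumr -!big_split mulr_sumr /=; apply: eq_bigr => c _.
by rewrite walk_wtS /walk_step; ring.
Qed.

Definition walk_gf q l a b : fps R := Fps (fun n => walk_wt q l n a b).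

End WalkSeries.

Section WalkResolvent.
Variable R : comUnitRingType.
Variable q : R.
Implicit Types (l t : R) (F : nat -> fps R).

Local Notation step l := (walk_step (fpsC q) (fpsC l)).

Lemma coef_walk_step l F a n :
  step l F a n = walk_step q l (fun c => F c n) a.
Proof.
rewrite /walk_step -rmorphXn coef_fpsCM coef_fpsD; congr (_ * (_ + _)).
case: a => [|a]; first by rewrite coef_fpsCM.
by rewrite coef_fpsD -(rmorph_nat (@fpsC R)) coef_fpsCM.
Qed.

(** The factor x makes coefficient n+1 depend only on coefficients of degree n. *)
Lemma walk_step_unique l t (r : nat -> fps R) F F' :
  (forall a, F a = r a + fpsX * (fpsC t * step l F a)) ->
  (forall a, F' a = r a + fpsX * (fpsC t * step l F' a)) -> F =1 F'.
Proof.
move=> FE F'E a; apply: fpsP => n; elim: n a => [|n IHn] a;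
  rewrite FE F'E !coef_fpsD !coef_fpsXM // !coef_fpsCM !coef_walk_step.
by rewrite /walk_step !IHn; case: a => // a; rewrite !IHn.
Qed.

Lemma walk_gfE l a b :
  walk_gf q l a b = (a == b)%:R + fpsX * step l (walk_gf q l ^~ b) a.
Proof.
apply: fpsP => n; rewrite coef_fpsD coef_fpsXM -(rmorph_nat (@fpsC R)).
case: n => [|n]; first by rewrite addr0.
by rewrite [fpsC _ _]/= add0r coef_walk_step.
Qed.

(** Raising a walk by one multiplies each step by q, which is the substitution of q x for x. *)
Lemma walk_gf_dil l a b : fps_dil q (walk_gf q l a b) =
  (a == b)%:R + fpsX * (fpsC q * step l (fun c => fps_dil q (walk_gf q l c b)) a).
Proof.
rewrite walk_gfE rmorphD rmorphM /= rmorph_nat fps_dilX -mulrA; congr (_ + _ * (_ * _)).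
rewrite /walk_step rmorphM rmorphXn /= fps_dilC; congr (_ * _).
case: a => [|a]; rewrite !rmorphD !rmorphM //= ?fps_dilC ?rmorph_nat //.
Qed.

(* The walks from a.+1 to b.+1 that avoid height 0 are the shifted walks from a
   to b; the others are cut at height 0. *)
Lemma walk_gf_avoid0 l a b :
  walk_gf q l a.+1 b.+1 * walk_gf q l 0 0 - walk_gf q l a.+1 0 * walk_gf q l 0 b.+1 =
  walk_gf q l 0 0 * fps_dil q (walk_gf q 2 a b).
Proof.
pose D a := walk_gf q l a b.+1 * walk_gf q l 0 0 - walk_gf q l a 0 * walk_gf q l 0 b.+1.
(* As [D] vanishes at 0, its values at positive heights satisfy the shifted system with two labels
   at the lowest level. *)
have D0 : D 0%N = 0 by rewrite /D mulrC subrr.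
apply: (@walk_step_unique 2 q (fun a => (a == b)%:R * walk_gf q l 0 0)
   (fun a => D a.+1) (fun a => walk_gf q l 0 0 * fps_dil q (walk_gf q 2 a b))) => {}a.
  rewrite {1}/D [walk_gf q l a.+1 b.+1]walk_gfE [walk_gf q l a.+1 0]walk_gfE.
  rewrite eqSS /= add0r mulrDl -addrA; congr (_ + _).
  rewrite /walk_step exprS (rmorph_nat (@fpsC R)).
  case: a => [|a].
    transitivity (fpsX * (fpsC q * (1 * (D 0%N + 2 * D 1%N + D 2%N)))).
      by rewrite /D expr0; ring.
    by rewrite D0 expr0; ring.
  by rewrite /D; ring.
rewrite {1}walk_gf_dil /walk_step.
by case: a => [|a]; ring.
Qed.

(** Closed walks of length n that reach height 0: from those starting at a, the ones that stay
    positive are subtracted. A walk reaching 0 starts at height at most n. *)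
Definition touching_wt l n : R :=
  \sum_(a < n.+1) (walk_wt q l n a a -
    (if nat_of_ord a is a'.+1 then q ^+ n * walk_wt q 2 n a' a' else 0)).

Definition touching_gf l : fps R := Fps (touching_wt l).

Definition touching_at l a : fps R := walk_gf q l a a -
  (if a is a'.+1 then fps_dil q (walk_gf q 2 a' a') else 0).

(** This is [walk_gf_avoid0] on the diagonal, divided by the series of walks from 0 to 0. *)
Lemma touching_atE l a :
  touching_at l a = (walk_gf q l 0 0)^-1 * walk_gf q l a 0 * walk_gf q l 0 a.
Proof.
have U : walk_gf q l 0 0 \is a GRing.unit by apply: fps_unitM0.
apply: (mulrI U); rewrite !mulrA mulrV // mul1r /touching_at.
case: a => [|a]; first by rewrite subr0.
by rewrite mulrBr -walk_gf_avoid0; ring.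
Qed.

Lemma touching_at_small l : fps_small (touching_at l).
Proof.
move=> a n na; rewrite touching_atE -mulrA mulrC -mulrA coef_fpsM big1 // => i _.
rewrite [walk_gf _ _ _ _ _](walk_wt_far _ _ _) ?mul0r // add0n.
by apply: leq_ltn_trans na; rewrite -ltnS.
Qed.

Lemma touching_gf_sum l : touching_gf l = fps_sum (touching_at l).
Proof.
by apply: fpsP => n; apply: eq_bigr => -[[|a] an] _.
Qed.

(** By [touching_atE] the left side counts pairs of a walk from 0 to a and a walk from a to 0. Such
    a pair is a closed walk at 0 of length n with one of n+1 cutting points. *)
Lemma touching_gfE l : walk_gf q l 0 0 * touching_gf l =
  walk_gf q l 0 0 + fps_euler (walk_gf q l 0 0).
Proof.
have U : walk_gf q l 0 0 \is a GRing.unit by apply: fps_unitM0.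
rewrite touching_gf_sum fps_sumM; last exact: touching_at_small.
apply: fpsP => n; rewrite coef_fpsD.
transitivity (\sum_(a < n.+1) \sum_(i < n.+1)
    walk_wt q l (n - i) 0 a * walk_wt q l i a 0).
  apply: eq_bigr => a _; rewrite touching_atE !mulrA mulrV // mul1r coef_fpsM.
  by apply: eq_bigr => i _; rewrite mulrC.
rewrite exchange_big /= (eq_bigr (fun=> walk_wt q l n 0 0)) => [|i _].
  by rewrite sumr_const card_ord mulrS.
by rewrite walk_wt_comp ?subnK //; have := ltn_ord i; lia.
Qed.

End WalkResolvent.

(** * The series J *)

Lemma qpochSr (R : comUnitRingType) (a q : R) n :
  qpoch a q n.+1 = qpoch a q n * (1 - a * q ^+ n).
Proof. by rewrite /qpoch big_ord_recr. Qed.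

Lemma qpochSl (R : comUnitRingType) (a q : R) n :
  qpoch a q n.+1 = (1 - a) * qpoch (a * q) q n.
Proof.
rewrite /qpoch big_ord_recl expr0 mulr1; congr (_ * _).
by apply: eq_bigr => i _; rewrite /= exprS mulrA.
Qed.

Section QTerms.
Variable R : comUnitRingType.
Implicit Types u q : R.

Definition qterm q u n : R :=
  (- u) ^+ n * q ^+ 'C(n, 2) / (qpoch q q n * qpoch (u * q) q n).

(** The factor 1 - q^(n+1) cancels the last factor of (q;q)_(n+1), and the first factor of
    (uq;q)_(n+1) is split off. *)
Lemma qtermS q u n : qpoch q q n.+1 \is a GRing.unit ->
  qpoch (u * q) q n.+1 \is a GRing.unit ->
  (1 - q ^+ n.+1) * qterm q u n.+1 = - (u / (1 - u * q)) * qterm q (u * q) n.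
Proof.
rewrite /qterm [qpoch q q n.+1]qpochSr -exprS qpochSl binS bin1 !unitrM.
move=> /andP[A a] /andP[b B]; rewrite !invrM ?unitrM ?A ?a ?b ?B //.
have N : (- (u * q)) ^+ n = (- u) ^+ n * q ^+ n by rewrite -mulNr exprMn.
rewrite [(- u) ^+ n.+1]exprS exprD N.
have e := mulrV a; move: e; set c := 1 - q ^+ n.+1; set c' := c^-1 => e.
transitivity (c * c' * (- u * (- u) ^+ n *
  (q ^+ 'C(n, 2) * q ^+ n) * ((qpoch q q n)^-1 * ((qpoch (u * q * q) q n)^-1 * (1 - u * q)^-1)))).
  by ring.
by rewrite e; ring.
Qed.

(** The product (uq;q)_(n+1) is split at its first and at its last factor. *)
Lemma qterm_shift q u n : qpoch q q n \is a GRing.unit ->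
  qpoch (u * q) q n \is a GRing.unit -> qpoch (u * q * q) q n \is a GRing.unit ->
  (1 - u * q * q ^+ n) * qterm q (u * q) n = (1 - u * q) * (q ^+ n * qterm q u n).
Proof.
move=> A B B'.
have E : (1 - u * q * q ^+ n) / qpoch (u * q * q) q n = (1 - u * q) / qpoch (u * q) q n.
  apply: (mulIr B'); rewrite mulrVK //; apply: (mulIr B).
  by rewrite mulrC -qpochSr qpochSl [RHS]mulrAC mulrVK.
have N : (- (u * q)) ^+ n = (- u) ^+ n * q ^+ n by rewrite -mulNr exprMn.
rewrite /qterm !invrM // N.
transitivity ((- u) ^+ n * q ^+ n * q ^+ 'C(n, 2) / qpoch q q n *
  ((1 - u * q * q ^+ n) / qpoch (u * q * q) q n)); first by ring.
by rewrite E; ring.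
Qed.

Lemma qterm_rmorph (phi : {rmorphism R -> R}) q u n : phi q = q ->
  qpoch q q n \is a GRing.unit -> qpoch (u * q) q n \is a GRing.unit ->
  phi (qterm q u n) = qterm q (phi u) n.
Proof.
move=> phiq A B.
have phi_qpoch a : phi (qpoch a q n) = qpoch (phi a) q n.
  rewrite rmorph_prod; apply: eq_bigr => i _.
  by rewrite rmorphB rmorph1 rmorphM rmorphXn phiq.
rewrite /qterm rmorphM rmorphV ?unitrM ?A // !rmorphM !rmorphXn rmorphN.
by rewrite !phi_qpoch rmorphM phiq.
Qed.

(** Elimination of J from the relations between J and H leaves a three-term recurrence for H
    alone. *)
Lemma qrec_elim u v w (J1 J2 H0 H1 H2 : R) : 1 - v \is a GRing.unit ->
  H1 = J1 + u / (1 - v) * J2 -> (1 - v) * H1 = J2 - v * H2 ->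
  w * H0 = J1 - u * H1 ->
  w * H0 = (1 - u *+ 2) * H1 - u * v / (1 - v) * H2.
Proof.
move=> V I1 I2 ->; have e := mulrV V.
have {}I1 : J1 = H1 - u / (1 - v) * J2 by rewrite I1 addrK.
have {}I2 : J2 = (1 - v) * H1 + v * H2 by rewrite I2 subrK.
rewrite I1 I2; move: e; set V' := (1 - v)^-1 => e.
transitivity (H1 - u * ((1 - v) * V') * H1 - u * v * V' * H2 - u * H1); first by ring.
by rewrite e; ring.
Qed.

(** The product of x q^i / (1 - x q^i) for i from 1 to a. *)
Definition qscale (x q : R) a : R := x ^+ a * q ^+ 'C(a.+1, 2) / qpoch (x * q) q a.

Lemma qscaleS x q a : qpoch (x * q) q a.+1 \is a GRing.unit ->
  qscale x q a.+1 = qscale x q a * (x * q ^+ a * q) / (1 - x * q ^+ a * q).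
Proof.
rewrite /qscale qpochSr binS bin1 exprS exprD exprSr.
have -> : x * q * q ^+ a = x * q ^+ a * q by ring.
by rewrite unitrM => /andP[A B]; rewrite invrM //; ring.
Qed.

(** The recurrence for H becomes the walk equation at height a+1, with c the scale factor at height
    a, u = x q^(a+1) and v = x q^(a+2). *)
Lemma qwalk_elim (c u v k H0 H1 H2 : R) : 1 - u \is a GRing.unit ->
  (1 - u) * H0 = (1 - u *+ 2) * H1 - u * v / (1 - v) * H2 ->
  c * u / (1 - u) * H1 / k = u * ((c * H0 / k + 2 * (c * u / (1 - u) * H1 / k)) +
    (c * u / (1 - u) * v / (1 - v)) * H2 / k).
Proof.
move=> U I; have e := mulrV U.
have -> : H0 = (1 - u)^-1 * ((1 - u *+ 2) * H1 - u * v / (1 - v) * H2).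
  by rewrite -I mulKr.
by ring.
Qed.

End QTerms.

Section WalkSolution.
Variables (R : comUnitRingType) (t l : R).
Local Notation q := (fpsC t).
Local Notation x := (@fpsX R).

Lemma unit_subr (u : fps R) : u 0%N = 0 -> 1 - u \is a GRing.unit.
Proof. by move=> u0; apply: fps_unitM0; rewrite coef_fpsD coef_fpsN u0 subr0. Qed.

Lemma unit_addr (f g : fps R) :
  f \is a GRing.unit -> g 0%N = 0 -> f + g \is a GRing.unit.
Proof. by rewrite !fps_unitE coef_fpsD => fU ->; rewrite addr0. Qed.

Lemma coef0_XM (f : fps R) : (x * f) 0%N = 0.
Proof. by rewrite coef_fpsM0 mul0r. Qed.

Lemma coef0_mulC (u : fps R) : u 0%N = 0 -> (u * q) 0%N = 0.
Proof. by move=> u0; rewrite coef_fpsM0 u0 mul0r. Qed.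

(* The walk series solve a linear system whose solution is unique, so it is
   enough to exhibit one: here H (x q^a) up to an explicit factor. *)
Lemma walk_gf_solve (H : fps R -> fps R) (K : fps R) : K \is a GRing.unit ->
  (forall u : fps R, u 0%N = 0 -> (1 - u * q) * H u =
    (1 - u * q *+ 2) * H (u * q) -
    u * q * (u * q * q) / (1 - u * q * q) * H (u * q * q)) ->
  H x = K + x * (fpsC l * H x + x * q / (1 - x * q) * H (x * q)) ->
  walk_gf t l 0 0 = H x / K.
Proof.
move=> KU Hrec K0; pose F a := qscale x q a * H (x * q ^+ a) / K.
have u0 a : (x * q ^+ a) 0%N = 0 by rewrite coef_fpsM0 mul0r.
have scale0 : qscale x q 0 = 1.
  by rewrite /qscale /qpoch big_ord0 !expr0 invr1 !mulr1.
have scaleS a : qscale x q a.+1 = qscale x q a * (x * q ^+ a * q) / (1 - x * q ^+ a * q).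
  apply: qscaleS; apply: rpred_prod => i _; apply: unit_subr.
  by rewrite -mulrA coef_fpsM0 mul0r.
have F0 : F 0%N = H x / K by rewrite /F scale0 expr0 mulr1 mul1r.
have F1 : F 1%N = x * q / (1 - x * q) * H (x * q) / K.
  by rewrite /F scaleS scale0 expr0 expr1 mulr1 mul1r.
rewrite -F0.
apply: (@walk_step_unique _ t l 1 (fun a => (a == 0%N)%:R) (walk_gf t l ^~ 0%N) F) => a.
  by rewrite rmorph1 mul1r; apply: walk_gfE.
rewrite rmorph1 mul1r /walk_step; case: a => [|a].
  rewrite expr0 mul1r F0 F1 {1}K0 mulrDl mulrV //; congr (_ + _).
  by rewrite -mulrA mulrDl mulrA.
rewrite add0r mulrA.
have uE : x * q ^+ a.+1 = x * q ^+ a * q by rewrite exprSr mulrA.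
have uE2 : x * q ^+ a.+2 = x * q ^+ a * q * q by rewrite exprSr mulrA uE.
rewrite /F (scaleS a.+1) uE2 uE (scaleS a).
apply: qwalk_elim; last exact: Hrec.
by apply: unit_subr; apply: coef0_mulC.
Qed.

Lemma JH_rec_elim (J0 J1 H0 H1 : fps R) :
  H0 = J0 + x / (1 - x * q) * J1 -> (1 - x * q) * H0 = J1 - x * q * H1 ->
  H0 = J0 + x * H0 + x * (x * q / (1 - x * q) * H1).
Proof.
move=> I1 I2; have d : 1 - x * q \is a GRing.unit by apply/unit_subr/coef0_mulC.
have J1E : J1 = (1 - x * q) * H0 + x * q * H1 by rewrite I2 subrK.
have e := mulrV d; rewrite {1}I1 J1E; move: e; set d' := (1 - x * q)^-1 => e.
transitivity (J0 + x * ((1 - x * q) * d') * H0 + x * (x * q * d' * H1)); first by ring.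
by rewrite e mulr1.
Qed.

End WalkSolution.

Section JIdentities.
Implicit Types u : fps Qq.
Local Notation q := varq.

Lemma coef0_mulq u : u 0%N = 0 -> (u * q) 0%N = 0.
Proof. by move=> u0; rewrite coef_fpsM0 u0 mul0r. Qed.

Lemma JtermS u n : u 0%N = 0 ->
  (1 - q ^+ n.+1) * Jterm u n.+1 = - (u / (1 - u * q)) * Jterm (u * q) n.
Proof. by move=> u0; apply: qtermS; [apply: qpoch_q_unit|apply: qpoch_u_unit]. Qed.

Lemma Jterm_shift u n : u 0%N = 0 ->
  (1 - u * q * q ^+ n) * Jterm (u * q) n = (1 - u * q) * (q ^+ n * Jterm u n).
Proof.
move=> u0; apply: qterm_shift; [exact: qpoch_q_unit|exact: qpoch_u_unit|].
exact/qpoch_u_unit/coef0_mulq.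
Qed.

Definition JH u : fps Qq := fps_sum (fun n => q ^+ n * Jterm u n).

Lemma Jterm_fps_small u : u 0%N = 0 -> fps_small (Jterm u).
Proof. by move=> u0 k n; apply: Jterm_small. Qed.

Lemma qJterm_fps_small u : u 0%N = 0 -> fps_small (fun n => q ^+ n * Jterm u n).
Proof. by move=> u0; apply/fps_smallMl/Jterm_fps_small. Qed.

(** The terms of J - H carry the factor 1 - q^n, so that the term of index 0 vanishes and [JtermS]
    applies to the others. *)
Lemma JH_J u : u 0%N = 0 -> JH u = J u + u / (1 - u * q) * J (u * q).
Proof.
move=> u0; suff K : J u - JH u = - (u / (1 - u * q)) * J (u * q).
  by rewrite -[u / _ * _]opprK -mulNr -K subKr.
have uq0 := coef0_mulq u0.
rewrite [RHS]fps_sumM; last exact: Jterm_fps_small.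
rewrite [LHS]fps_sum_qdiff; last exact: Jterm_fps_small.
by apply: eq_fps_sum => n; apply: JtermS.
Qed.

Lemma JH_mulq u : u 0%N = 0 ->
  (1 - u * q) * JH u = J (u * q) - u * q * JH (u * q).
Proof.
move=> u0; have uq0 := coef0_mulq u0.
rewrite /J /JH !fps_sumM; try exact: qJterm_fps_small.
rewrite fps_sumB; apply: eq_fps_sum => n.
by rewrite -Jterm_shift //; ring.
Qed.

Lemma JH_mulq_rec u : u 0%N = 0 -> (1 - u * q) * JH u =
  (1 - u * q *+ 2) * JH (u * q) -
  u * q * (u * q * q) / (1 - u * q * q) * JH (u * q * q).
Proof.
move=> u0; have uq0 := coef0_mulq u0.
apply: (qrec_elim (unit_subr (coef0_mulq uq0)) (JH_J uq0) (JH_mulq uq0)).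
exact: JH_mulq.
Qed.

Local Notation x := varx.

Lemma coef0_x : x 0%N = 0. Proof. by []. Qed.

(** The constant [K] in [Jscale_walk] for l = 2: the second label at height 0 adds x H to the
    boundary equation. *)
Definition JQ : fps Qq := J x - x * JH x.

Lemma Jscale_walk (l : Qq) (K : fps Qq) : K \is a GRing.unit ->
  JH x = K + x * (fpsC l * JH x + x * q / (1 - x * q) * JH (x * q)) ->
  walk_gf (tofrac 'X : Qq) l 0 0 = JH x / K.
Proof.
move=> KU K0.
apply: (@walk_gf_solve _ _ _ JH) => // u u0; exact: JH_mulq_rec.
Qed.

Lemma JH_rec : JH x = J x + x * JH x + x * (x * q / (1 - x * q) * JH (x * q)).
Proof.
exact: JH_rec_elim (JH_J coef0_x) (JH_mulq coef0_x).
Qed.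

Lemma walk_gf1_J : walk_gf (tofrac 'X : Qq) 1 0 0 = JH x / J x.
Proof.
apply: Jscale_walk; first exact: J_unit.
by rewrite rmorph1 mul1r mulrDr addrA -JH_rec.
Qed.

Lemma JQ_unit : JQ \is a GRing.unit.
Proof.
have := J_unit x; rewrite !fps_unitE /JQ coef_fpsD coef_fpsN coef_fpsM0.
by rewrite mul0r subr0.
Qed.

Lemma walk_gf2_J : walk_gf (tofrac 'X : Qq) 2 0 0 = JH x / JQ.
Proof.
apply: Jscale_walk; first exact: JQ_unit.
rewrite {1}JH_rec /JQ (rmorph_nat (@fpsC Qq)) mulr_natl mulr2n !mulrDr.
by rewrite !addrA subrK.
Qed.

Lemma JH_unit : JH x \is a GRing.unit.
Proof.
rewrite (JH_J coef0_x); apply: unit_addr; first exact: J_unit.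
by rewrite -[_ * J _]mulrA; apply: coef0_XM.
Qed.

Lemma fps_dil_Jterm n : fps_dil (tofrac 'X : Qq) (Jterm x n) = Jterm (x * q) n.
Proof.
rewrite -fps_dilX; apply: qterm_rmorph; first exact: fps_dilC.
  exact: qpoch_q_unit.
exact: qpoch_u_unit.
Qed.

(** By [JH_mulq]. This relation makes the contributions of [JQ] cancel in the count of all closed
    walks. *)
Lemma fps_dil_JQ : fps_dil (tofrac 'X : Qq) JQ = (1 - x * q) * JH x.
Proof.
rewrite JH_mulq // /JQ rmorphB rmorphM /= fps_dilX; congr (_ - _ * _).
  by rewrite fps_dil_sum; apply: eq_fps_sum => n; apply: fps_dil_Jterm.
rewrite fps_dil_sum; apply: eq_fps_sum => n.
by rewrite rmorphM rmorphXn /= fps_dilC fps_dil_Jterm.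
Qed.

End JIdentities.

(** * Generating functions *)

Section LogDerivative.
Variable R : comUnitRingType.
Implicit Types (f g : fps R) (t : R).

Definition fps_logd f : fps R := fps_euler f / f.

Lemma fps_logdM f g : f \is a GRing.unit -> g \is a GRing.unit ->
  fps_logd (f * g) = fps_logd f + fps_logd g.
Proof.
move=> fU gU; rewrite /fps_logd fps_eulerM invrM //.
have := mulrV fU; have := mulrV gU; set f' := f^-1; set g' := g^-1 => eg ef.
transitivity (fps_euler f * f' * (g * g') + fps_euler g * g' * (f * f')); first by ring.
by rewrite eg ef !mulr1.
Qed.

Lemma fps_logd_dil t f : f \is a GRing.unit ->
  fps_logd (fps_dil t f) = fps_dil t (fps_logd f).
Proof.
by move=> fU; rewrite /fps_logd fps_euler_dil [RHS]rmorphM rmorphV.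
Qed.

Lemma coef_fpsXnM k f n :
  (fpsX ^+ k * f) n = if (n < k)%N then 0 else f (n - k)%N.
Proof.
elim: k n => [|k IHk] n; first by rewrite expr0 mul1r subn0.
by rewrite exprS -mulrA coef_fpsXM; case: n => [|n] //; rewrite IHk ltnS subSS.
Qed.

Lemma fps_logd_geom t n : fps_logd (1 - fpsX * fpsC t) n.+1 = - t ^+ n.+1.
Proof.
pose s : fps R := Fps (fun n => if n is m.+1 then - t ^+ m.+1 else 0).
suff -> : fps_logd (1 - fpsX * fpsC t) = s by [].
have U : 1 - fpsX * fpsC t \is a GRing.unit.
  by apply: fps_unitM0; rewrite coef_fpsD coef_fpsN mulrC coef_fpsCM mulr0 subr0.
apply: (mulIr U); rewrite /fps_logd mulrVK //; apply: fpsP => m.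
have -> : s * (1 - fpsX * fpsC t) = s - fpsX * (fpsC t * s) by ring.
rewrite coef_fpsD coef_fpsN coef_fpsXM.
rewrite -[fps_euler _ m]/((1 - fpsX * fpsC t : fps R) m *+ m) coef_fpsD coef_fpsN.
rewrite [fpsX * fpsC t]mulrC coef_fpsCM coef_fps1.
case: m => [|[|m]]; first by rewrite mulr0n subr0.
  by rewrite coef_fpsCM /= mulr0 mulr1 subr0 sub0r.
by rewrite coef_fpsCM /= mulr0 subrr mul0rn mulrN -exprS opprK addNr.
Qed.

Lemma fps_logd_walk f z : f \is a GRing.unit -> f * z = f + fps_euler f ->
  z = 1 + fps_logd f.
Proof.
move=> fU fz; apply: (mulrI fU); rewrite fz mulrDr mulr1; congr (_ + _).
by rewrite /fps_logd mulrCA mulrV // mulr1.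
Qed.

(** The series z1 and z2 count closed walks touching 0 for l = 1 and l = 2, and h, j, k are H, J, Q.
    Each z is a difference of logarithmic derivatives in positive degree. The relation between k and
    h then removes both of them and contributes one t^(n+1) from the geometric factor. *)
Lemma closed_walk_logd t (g1 g2 z1 z2 h j k : fps R) n :
  h \is a GRing.unit -> j \is a GRing.unit -> k \is a GRing.unit ->
  g1 = h / j -> g2 = h / k -> fps_dil t k = (1 - fpsX * fpsC t) * h ->
  g1 * z1 = g1 + fps_euler g1 -> g2 * z2 = g2 + fps_euler g2 ->
  z1 n.+1 * (1 - t ^+ n.+1) + t ^+ n.+1 * z2 n.+1 - 2 * t ^+ n.+1 =
  - (1 - t ^+ n.+1) * fps_logd j n.+1 - t ^+ n.+1.
Proof.
move=> hU jU kU g1E g2E kE z1E z2E.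
have logd_div (f g e : fps R) : f \is a GRing.unit -> g \is a GRing.unit -> e = f / g ->
    e \is a GRing.unit /\ fps_logd e = fps_logd f - fps_logd g.
  move=> fU gU ->; have eU : f / g \is a GRing.unit by rewrite unitrM unitrV fU.
  by split=> //; have := fps_logdM eU gU; rewrite mulrVK // => ->; rewrite addrK.
have [g1U L1] := logd_div _ _ _ hU jU g1E; have [g2U L2] := logd_div _ _ _ hU kU g2E.
have dU : 1 - fpsX * fpsC t \is a GRing.unit.
  by apply: unit_subr; rewrite coef_fpsM0 mul0r.
have := congr1 (fun f => fps_logd f n.+1) kE; rewrite fps_logd_dil // fps_logdM //.
rewrite coef_fpsD fps_logd_geom.
rewrite -[fps_dil _ _ _]/(t ^+ n.+1 * fps_logd k n.+1) => E.
have Z (z g a b : fps R) : g \is a GRing.unit -> g * z = g + fps_euler g ->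
    fps_logd g = a - b -> z n.+1 = a n.+1 - b n.+1.
  by move=> gU /(fps_logd_walk gU) -> ->; rewrite coef_fpsD coef_fps1 /= add0r.
rewrite (Z _ _ _ _ g1U z1E L1) (Z _ _ _ _ g2U z2E L2) [t ^+ n.+1 * (_ - _)]mulrBr E.
by ring.
Qed.

End LogDerivative.

(** Walks are counted by polynomials in q, while J lives over rational functions; this carries the
    weights from one ring to the other. *)
Lemma walk_wt_rmorph (R S : comUnitRingType) (phi : {rmorphism R -> S}) (q l : R) n a b :
  phi (walk_wt q l n a b) = walk_wt (phi q) (phi l) n a b.
Proof.
elim: n a => [|n IHn] a; first by rewrite /walk_wt /= rmorph_nat.
rewrite !walk_wtS /walk_step rmorphM rmorphXn rmorphD IHn; congr (_ * (_ + _)).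
by case: a => [|a]; rewrite ?rmorphD !rmorphM !IHn ?rmorph_nat.
Qed.

Lemma touching_wt_rmorph (R S : comUnitRingType) (phi : {rmorphism R -> S}) (q l : R) n :
  phi (touching_wt q l n) = touching_wt (phi q) (phi l) n.
Proof.
rewrite rmorph_sum; apply: eq_bigr => -[a an] _ /=; rewrite rmorphB walk_wt_rmorph.
congr (_ - _); case: a {an} => [|a]; first by rewrite rmorph0.
by rewrite rmorphM rmorphXn walk_wt_rmorph rmorph_nat.
Qed.

Lemma walks_sum (R : comUnitRingType) (q : R) n a b :
  \sum_(s <- walks n a b) q ^+ area s = walk_wt q 1 n a b.
Proof.
elim: n a => [|n IHn] a.
  by rewrite /walk_wt /=; case: eqP; rewrite ?big_seq1 ?big_nil.
have E d f (L : seq (seq (nat * bool))) :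
    \sum_(s <- map (cons (d, f)) L) q ^+ area s = q ^+ d * \sum_(s <- L) q ^+ area s.
  by rewrite big_map mulr_sumr; apply: eq_bigr => s _; rewrite /area /= exprD.
rewrite walk_wtS /walk_step; case: a => [|a].
  by rewrite [walks _ _ _]/= cats0 E big_cat !IHn mul1r.
rewrite [walks _ _ _]/= big_cat !E !big_cat /= !IHn; ring.
Qed.

Lemma coef_sum_Xn (T : eqType) (L : seq T) (w : T -> nat) k :
  (\sum_(s <- L) 'X^(w s) : {poly rat})`_k = (size [seq s <- L | w s == k])%:R.
Proof.
rewrite coef_sum size_filter -sum1_count natr_sum [RHS]big_mkcond /=.
by apply: eq_bigr => s _; rewrite coefXn eq_sym; case: eqP.
Qed.

Lemma walk_wt_coef_small (l : {poly rat}) n a b k : (k < a)%N ->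
  (walk_wt 'X l n.+1 a b)`_k = 0.
Proof. by move=> ka; rewrite walk_wtS /walk_step coefXnM ka. Qed.

Section FpsOfPoly.
Variable R : comUnitRingType.

Lemma fps_of_polyB (p r : {poly R}) :
  fps_of_poly (p - r) = fps_of_poly p - fps_of_poly r.
Proof. by apply: fpsP => n; rewrite coef_fpsD coef_fpsN /= coefB. Qed.

Lemma fps_of_polyD (p r : {poly R}) :
  fps_of_poly (p + r) = fps_of_poly p + fps_of_poly r.
Proof. by apply: fpsP => n; rewrite coef_fpsD /= coefD. Qed.

Lemma fps_of_poly1 : fps_of_poly (1 : {poly R}) = 1.
Proof. by apply: fpsP => n; rewrite coef_fps1 /= coef1. Qed.

Lemma fps_of_polyXn k : fps_of_poly ('X^k : {poly R}) = fpsX ^+ k.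
Proof.
apply: fpsP => n; rewrite -[fpsX ^+ k]mulr1 coef_fpsXnM coef_fps1 /= coefXn.
by rewrite subn_eq0; case: ltngtP.
Qed.

End FpsOfPoly.

(** * Closed walks of fixed length as a series in q *)

Section ClosedWalkSeries.
Variable n : nat.

(** The sum over all starting heights. A walk starting at a has weight divisible by q^a, so heights
    up to k suffice in degree k. *)
Definition diag_series (l : {poly rat}) : fps rat :=
  Fps (fun k => \sum_(a < k.+1) (walk_wt 'X l n.+1 a a)`_k).

Lemma diag_series_stable l B k : (k < B)%N ->
  diag_series l k = (\sum_(a < B) walk_wt 'X l n.+1 a a)`_k.
Proof.
move=> kB; rewrite coef_sum /=.
rewrite -!(big_mkord xpredT (fun a => (walk_wt 'X l n.+1 a a)`_k)).
rewrite [RHS](big_cat_nat _ kB) //= [X in _ + X]big_nat_cond.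
rewrite [X in _ + X]big1 ?addr0 // => a /andP[/andP[ka _] _].
by rewrite walk_wt_coef_small.
Qed.

(** A closed walk touches height 0, or is raised by one from a closed walk that has two labels at
    height 0. *)
Lemma diag_seriesE (l : {poly rat}) : diag_series l =
  fps_of_poly (touching_wt 'X l n.+1) + fps_of_poly 'X^(n.+1) * diag_series 2.
Proof.
(* The bound [B] exceeds both k and n+1, so all truncated sums can be taken over the same range. *)
apply: fpsP => k; rewrite coef_fpsD; set B := (k + n).+2.
rewrite (@diag_series_stable l B.+1); last by rewrite /B; lia.
have -> : (fps_of_poly 'X^(n.+1) * diag_series 2) k =
    ('X^(n.+1) * \sum_(a < B) walk_wt 'X 2 n.+1 a a)`_k.
  rewrite coef_fpsM coefM; apply: eq_bigr => i _; congr (_ * _).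
  by apply: diag_series_stable; rewrite /B; lia.
have -> : touching_wt 'X l n.+1 = \sum_(a < B.+1) touching_at 'X l a n.+1.
  rewrite -[LHS]/(touching_gf 'X l n.+1) touching_gf_sum.
  rewrite -coef_fps_sum; apply: fps_sum_stable; first exact: touching_at_small.
  by rewrite /B; lia.
rewrite -[fps_of_poly _ k]/((_ : {poly rat})`_k) -coefD; congr (nth 0 (polyseq _) k).
rewrite [LHS]big_ord_recl [X in _ = X + _]big_ord_recl mulr_sumr -addrA; congr (_ + _).
  by rewrite /touching_at subr0.
rewrite -big_split; apply: eq_bigr => a _.
rewrite -[touching_at _ _ _ _]/(walk_wt 'X l n.+1 a.+1 a.+1 -
  'X^(n.+1) * walk_wt 'X 2 n.+1 a a).
by rewrite /= subrK.
Qed.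

Lemma closed_walks_series k :
  (size (closed_walks n.+1 k))%:R = diag_series 1 k.
Proof.
rewrite /closed_walks filter_flatten size_flatten /shape -!map_comp sumnE big_map natr_sum.
rewrite -[RHS]/(\sum_(a < k.+1) (walk_wt 'X 1 n.+1 a a : {poly rat})`_k).
rewrite -(big_mkord xpredT (fun a => (walk_wt 'X 1 n.+1 a a : {poly rat})`_k)).
rewrite /index_iota subn0; apply: eq_bigr => a _.
by rewrite -(walks_sum 'X) coef_sum_Xn.
Qed.

Definition multiples_series : fps rat :=
  Fps (fun k => ((n.+1 %| k) && (0 < k))%N%:R).

Lemma multiples_seriesE :
  fps_of_poly (1 - 'X^(n.+1)) * multiples_series = fps_of_poly 'X^(n.+1).
Proof.
have -> : fps_of_poly (1 - 'X^(n.+1)) = 1 - fpsX ^+ n.+1 :> fps rat.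
  by rewrite fps_of_polyB fps_of_poly1 fps_of_polyXn.
rewrite fps_of_polyXn mulrBl mul1r; apply/eqP; rewrite subr_eq; apply/eqP/fpsP => k.
rewrite coef_fpsD coef_fpsXnM -[fpsX ^+ n.+1]mulr1 coef_fpsXnM coef_fps1.
rewrite -[multiples_series k]/(((n.+1 %| k) && (0 < k))%N%:R).
rewrite -[multiples_series _]/(((n.+1 %| (k - n.+1)) && (0 < k - n.+1))%N%:R).
case: (ltnP k n.+1) => kn.
  rewrite addr0; case: (posnP k) => [->|k0]; first by rewrite andbF.
  by rewrite gtnNdvd.
rewrite subn_eq0 subn_gt0 dvdn_subl ?dvdnn //.
move: kn; rewrite leq_eqVlt => /orP[/eqP<-|nk].
  by rewrite dvdnn leqnn ltnn andbF addr0.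
by rewrite [(k <= n.+1)%N]leqNgt nk (leq_ltn_trans _ nk) // add0r.
Qed.

End ClosedWalkSeries.

Lemma affineA_FC_series n : affineA_FC n =
  diag_series n 1 - 2 * multiples_series n.
Proof.
apply: fpsP => k; rewrite coef_fpsD coef_fpsN -(rmorph_nat (@fpsC rat)) coef_fpsCM.
rewrite -closed_walks_series.
suff [c -> cE] : exists2 c : nat, affineA_FC n k = c%:R &
    (c + (if (n.+1 %| k) && (0 < k) then 2 else 0))%N = size (closed_walks n.+1 k).
  rewrite -cE natrD /=; case: ifP => _; last by rewrite mulr0 subr0 addr0.
  by rewrite mulr1 addrK.
case: n => [|[|n]].
- exists (nat_of_bool (k == 0%N)); last exact: size_closed_walks1.
  by rewrite /affineA_FC coef_fps1.
- by eexists; last exact: card_fc_coxDinfty.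
- by eexists; last exact: card_fc_coxcycle.
Qed.

Lemma A_FC_series n : A_FC n = fps_of_poly (walk_wt 'X 1 n.+1 0 0).
Proof.
apply: fpsP => k; rewrite -[RHS]/((walk_wt 'X 1 n.+1 0 0 : {poly rat})`_k).
by rewrite -(walks_sum 'X) coef_sum_Xn -card_fc_coxA.
Qed.

Lemma tofrac_X_neq1 n : 1 - (tofrac 'X : Qq) ^+ n.+1 != 0.
Proof.
rewrite -tofracXn -tofrac1 -tofracB tofrac_eq0.
apply/eqP => /(congr1 (coefp 0))/eqP.
by rewrite /= coefB coef1 coefXn coef0 subr0 oner_eq0.
Qed.

Definition A_gf : fps Qq := (1 - varx * varq)^-1 * (J (varx * varq) / J varx).

(** The factor x is there because A_n corresponds to walks with n+1 steps. *)
Lemma A_gf_walk : walk_gf (tofrac 'X : Qq) 1 0 0 = 1 + varx * A_gf.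
Proof.
rewrite walk_gf1_J (JH_J coef0_x) mulrDl mulrV ?J_unit //; congr (_ + _).
by rewrite /A_gf -!mulrA.
Qed.

Lemma A_gf_x_series : is_x_series A_gf A_FC.
Proof.
move=> n; exists (walk_wt 'X 1 n.+1 0 0), 1; split; first exact: oner_neq0.
  have := congr1 (fun f : fps Qq => f n.+1) A_gf_walk.
  rewrite coef_fpsD coef_fps1 coef_fpsXM add0r => <-.
  by rewrite tofrac1 divr1 (walk_wt_rmorph (@tofrac _)) rmorph1.
by rewrite fps_of_poly1 mul1r A_FC_series.
Qed.

Lemma fps_sum_monomials (R : comUnitRingType) (c : nat -> R) n :
  fps_sum (fun k => if k is 0%N then 0 else fpsX ^+ k * fpsC (c k)) n.+1 = c n.+1.
Proof.
pose F k : R := (if k is 0%N then 0 else fpsX ^+ k * fpsC (c k)) n.+1.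
have FE k : F k.+1 = (fpsX ^+ k.+1 * fpsC (c k.+1)) n.+1 by [].
rewrite -[LHS]/(\sum_(k < n.+2) F k) big_ord_recr /= big1 => [|[[//|k] kn] _].
  by rewrite add0r FE coef_fpsXnM ltnn subnn.
rewrite FE coef_fpsXnM subSS; case: ltnP => // _.
by move: kn; rewrite ltnS -subn_gt0 /=; case: (n - k)%N.
Qed.

Definition At_gf : fps Qq := - varx * (fps_deriv (J varx) / J varx)
  - fps_sum (fun n => if n is 0%N then 0
                      else varx ^+ n * varq ^+ n / (1 - varq ^+ n)).

Lemma At_gf0 : At_gf 0%N = 0.
Proof.
rewrite coef_fpsD coef_fpsN coef_fpsM0 -[(- varx) 0%N]/(- varx 0%N).
by rewrite oppr0 mul0r add0r -[fps_sum _ 0%N]/(\sum_(k < 1) _) big_ord1 oppr0.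
Qed.

Lemma At_gfS n : At_gf n.+1 = - fps_logd (J varx) n.+1 -
  (tofrac 'X : Qq) ^+ n.+1 / (1 - (tofrac 'X : Qq) ^+ n.+1).
Proof.
rewrite coef_fpsD coef_fpsN; congr (_ - _).
  by rewrite mulNr mulrA fpsX_deriv.
rewrite -(fps_sum_monomials (fun k => (tofrac 'X : Qq) ^+ k / (1 - (tofrac 'X : Qq) ^+ k))).
congr (fpscoef _ _); apply: eq_fps_sum => -[//|k].
rewrite rmorphM rmorphXn rmorphV ?unitfE ?tofrac_X_neq1 //.
by rewrite rmorphB rmorph1 rmorphXn mulrA.
Qed.

Lemma mulfK_subr (F : fieldType) (d y s : F) : d != 0 ->
  - y - s / d = (- d * y - s) / d.
Proof. by move=> d0; rewrite mulrBl mulNr mulNr [d * y]mulrC mulfK. Qed.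

(** For l = 2, [diag_seriesE] is a geometric recursion, solved by multiplying with 1 - q^(n+1). The
    same factor clears the denominator of the constant walks, so the right side is a polynomial. *)
Lemma affineA_FC_expansion n :
  fps_of_poly (1 - 'X^(n.+1)) * affineA_FC n = fps_of_poly
    (touching_wt 'X 1 n.+1 * (1 - 'X^(n.+1)) + 'X^(n.+1) * touching_wt 'X 2 n.+1
     - 2 * 'X^(n.+1)).
Proof.
have E2 := diag_seriesE n 2; have E1 := diag_seriesE n 1; have Em := multiples_seriesE n.
rewrite !(fps_of_polyB, fps_of_polyD, fps_of_polyM, fps_of_poly1).
rewrite fps_of_polyB fps_of_poly1 in Em.
rewrite affineA_FC_series mulrBr mulrCA Em E1.
have {}E2 : fps_of_poly (touching_wt 'X 2 n.+1) =
    (1 - fps_of_poly 'X^(n.+1)) * diag_series n 2.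
  by rewrite mulrBl mul1r {1}E2 addrK.
by rewrite E2; ring.
Qed.

Lemma At_gf_x_series :
  is_x_series At_gf (fun n => if n is r.+1 then affineA_FC r else 0).
Proof.
case=> [|n].
  exists 0, 1; rewrite oner_neq0 At_gf0 rmorph0 mul0r mulr0; split=> //.
  by apply: fpsP => n; rewrite /= coef0.
exists (touching_wt 'X 1 n.+1 * (1 - 'X^(n.+1)) + 'X^(n.+1) * touching_wt 'X 2 n.+1
     - 2 * 'X^(n.+1)), (1 - 'X^(n.+1)); split; last exact: affineA_FC_expansion.
  by rewrite -tofrac_eq0 tofracB tofrac1 tofracXn tofrac_X_neq1.
rewrite At_gfS [tofrac (_ - 2 * _)]tofracB tofracD !tofracM tofracB tofrac1 tofracXn.
rewrite !(touching_wt_rmorph (@tofrac _)) rmorph1 !(rmorph_nat (@tofrac _)).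
(* Over Q(q) the numerator found above is the left side of [closed_walk_logd]. *)
have L := closed_walk_logd n JH_unit (J_unit varx) JQ_unit walk_gf1_J walk_gf2_J
  fps_dil_JQ (touching_gfE _ _) (touching_gfE _ _).
rewrite -[touching_wt (tofrac 'X) 1 n.+1]/(touching_gf (tofrac 'X) 1 n.+1).
rewrite -[touching_wt (tofrac 'X) 2 n.+1]/(touching_gf (tofrac 'X) 2 n.+1).
rewrite L.
exact/mulfK_subr/tofrac_X_neq1.
Qed.

Theorem theorem1p1 :
  exists A At : fps Qq,
    [/\ is_x_series A A_FC,
        is_x_series At (fun n => if n is r.+1 then affineA_FC r else 0),
        A = (1 - varx * varq)^-1 * (J (varx * varq) / J varx)
      & At = - varx * (fps_deriv (J varx) / J varx)
             - fps_sum (fun n => if n is 0%N then 0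
                                 else varx ^+ n * varq ^+ n / (1 - varq ^+ n))].
Proof.
by exists A_gf, At_gf; split; [apply: A_gf_x_series | apply: At_gf_x_series | |].
Qed.
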